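(* The symplectic form $\overline{\omega}_2$ on $\mathbb{C}P^2$, obtained from the symplectic cut of the unit cotangent disc bundle $U_1^*\mathbb{R}P^2$ along its boundary, is diffeomorphic to the form $2\omega_{FS}$, i.e. there is a diffeomorphism $f:\mathbb{C}P^2\to\mathbb{C}P^2$ with $f^*(2\omega_{FS})=\overline{\omega}_2$. In addition, the diffeomorphism can be chosen to fix both the standard $\mathbb{R}P^2$ and the quadric $Q^1$ (that is, to map each of them to itself).
   Context: $\omega_{FS}$ is the Fubini-Study form on $\mathbb{C}P^m$ normalized so that $\rho^2\,\mathrm{pr}_\rho^*\omega_{FS}$ equals the restriction of the standard form $\omega_{std}$ of $\mathbb{C}^{m+1}$ to the sphere $S^{2m+1}(\rho)$ of radius $\rho$, where $\mathrm{pr}_\rho:S^{2m+1}(\rho)\to\mathbb{C}P^m$ is the quotient by the scalar action. The standard $\mathbb{R}P^2\subset\mathbb{C}P^2$ is the set of points with real homogeneous coordinates. $Q^2=\{z_0^2+z_1^2+z_2^2+z_3^2=0\}\subset\mathbb{C}P^3$. $Q^1$ denotes the quadric $\{z_0^2+z_1^2+z_2^2=0\}\subset\mathbb{C}P^2$, and also $Q^2\cap\{z_3=0\}$. $T^*S^2$ is identified with $\{(p,q)\in\mathbb{R}^3\oplus\mathbb{R}^3:|p|=1,\ \langle p,q\rangle=0\}\subset\mathbb{C}^3$ via $z=p+iq$, with the restriction of $\omega_{std}$. $T^*\mathbb{R}P^2$ is its quotient by $(p,q)\mapsto(-p,-q)$ with the induced symplectic form. $U_1^*S^2$ and $U_1^*\mathbb{R}P^2$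 are the unit disc bundles $\{|q|<1\}$, and $\pi':U_1^*S^2\to U_1^*\mathbb{R}P^2$ is the quotient double cover. The co-geodesic flow is the flow of the Hamiltonian $H(p,q)=\frac12|q|^2$; it induces a circle action on the boundary $\{|q|=1\}$. The symplectic cut of $U_1^*\mathbb{R}P^2$ along its boundary is the closed symplectic manifold obtained from $\{|q|\le1\}$ by collapsing each orbit of this action on $\{|q|=1\}$ to a point, with the symplectic form that extends the given form on $U_1^*\mathbb{R}P^2$. Let $\iota:U_1^*S^2\hookrightarrow Q^2$ be $\iota(z)=[z_0:z_1:z_2:i\sqrt{2-|z|^2}]$, let $\pi:Q^2\to\mathbb{C}P^2$ be the restriction of the projection $[z_0:z_1:z_2:z_3]\mapsto[z_0:z_1:z_2]$, a double cover branched along $Q^1$, and let $\iota':U_1^*\mathbb{R}P^2\hookrightarrow\mathbb{C}P^2$ be the inclusion with $\pi\circ\iota=\iota'\circ\pi'$, i.e. $\iota'([p+iq])=[p+iq]$; it maps the zero section to the standard $\mathbb{R}P^2$ and has image $\mathbb{C}P^2-Q^1$. The inclusion $\iota'$ extends to a diffeomorphism from the symplectic cut of $U_1^*\mathbb{R}P^2$ to $\mathbb{C}P^2$, and $\overline{\omega}_2$ is the form on $\mathbb{C}P^2$ corresponding to the form of the cut under this diffeomorphism. It satisfies $\pi^*\overline{\omega}_2=2\omega_{FS}|_{Q^2}$.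
   Formalization: The extension of ι' from the cut to CP² is only a homeomorphism for the usual smooth structure (like w↦|w|w near Q¹), so the source CP² of f carries the smooth structure transported from the cut; the target CP² has the usual one. *)

(* Defs.v *)
From HB Require Import structures.
From mathcomp Require Import all_boot all_order all_algebra.
From mathcomp Require Import all_classical all_reals all_analysis.
From mathcomp Require Import complex.

Set Implicit Arguments.
Unset Strict Implicit.
Unset Printing Implicit Defensive.
Import Order.TTheory GRing.Theory Num.Theory numFieldNormedType.Exports.
Local Open Scope classical_set_scope.
Local Open Scope ring_scope.

Section Smooth.
Context {R : realType} {E : normedModType R}.

Fixpoint Ck_on (k : nat) (U : set E) (f : E -> R) : Prop :=
  (forall x, U x -> {for x, continuous f}) /\
  match k with
  | 0 => True
  | k'.+1 => forall v, (forall x, U x -> derivable f x v) /\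
                       Ck_on k' U (fun x => 'D_v f x)
  end.

Definition smooth_near (f : E -> R) (x : E) : Prop :=
  exists U : set E, [/\ open U, U x & forall k, Ck_on k U f].

(* C^m is a real manifold through the real and imaginary parts of the
   coordinates, and its tangent spaces are identified with C^m. *)
Definition csmooth_near (f : E -> R[i]) (x : E) : Prop :=
  smooth_near (fun y => complex.Re (f y)) x /\
  smooth_near (fun y => complex.Im (f y)) x.

Definition vsmooth_near m (L : E -> 'rV[R[i]]_m) (x : E) : Prop :=
  forall j, csmooth_near (fun y => L y 0 j) x.

Definition velocity m (L : E -> 'rV[R[i]]_m) (x u : E) : 'rV[R[i]]_m :=
  \row_j ('D_u (fun y => complex.Re (L y 0 j)) x +i*
          'D_u (fun y => complex.Im (L y 0 j)) x)%C.

End Smooth.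

(* A smooth structure on a set S of points is given by its plots, that is, the
  germs of smooth maps from the spaces R^n to S (a diffeology).  A manifold is
  given by the smooth maps into it; conversely a map between manifolds is
  smooth iff it preserves plots, and a 2-form on a manifold is the same thing
  as a family of 2-forms on the sources of the plots which is compatible with
  smooth changes of the source.  For a submersion pr : Z -> S onto S, where Z is
  a submanifold of a C^m, the plots of S are the maps with a local smooth lift
  to Z; this is how CP^m, T^*RP^2 and the symplectic cut are described below. *)

Section Structures.
Context {R : realType}.

(* [X n P x] reads "P is smooth near x"; the values of P far from x are
   irrelevant. *)
Definition plots (T : Type) := forall n : nat, ('rV[R]_n -> T) -> 'rV[R]_n -> Prop.

Definition rsmooth_near n m (phi : 'rV[R]_n -> 'rV[R]_m) (y : 'rV[R]_n) : Prop :=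
  forall j, smooth_near (fun z => phi z 0 j) y.

Definition rvelocity n m (phi : 'rV[R]_n -> 'rV[R]_m) (y u : 'rV[R]_n) :
  'rV[R]_m := \row_j 'D_u (fun z => phi z 0 j) y.

Definition smooth_structure (T : Type) (S : set T) (X : plots T) : Prop :=
  [/\ (forall n (P : 'rV[R]_n -> T) x, X n P x -> \forall y \near x, S (P y)),
      (forall n (a : T) (x : 'rV[R]_n), S a -> X n (fun=> a) x),
      (forall n (P : 'rV[R]_n -> T) x, X n P x -> \forall y \near x, X n P y),
      (forall n (P Q : 'rV[R]_n -> T) x, X n P x ->
         (\forall y \near x, P y = Q y) -> X n Q x)
    & (forall n m (P : 'rV[R]_m -> T) (phi : 'rV[R]_n -> 'rV[R]_m) y,
         rsmooth_near phi y -> X m P (phi y) -> X n (P \o phi) y)].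

Definition smooth_map (T T' : Type) (X : plots T) (X' : plots T') (f : T -> T') :=
  forall n (P : 'rV[R]_n -> T) x, X n P x -> X' n (f \o P) x.

Definition diffeomorphism (T T' : Type) (S : set T) (X : plots T)
    (S' : set T') (X' : plots T') (f : T -> T') : Prop :=
  [/\ set_bij S S' f, smooth_map X X' f
    & exists g : T' -> T, [/\ smooth_map X' X g,
        (forall a, S a -> g (f a) = a) & (forall b, S' b -> S (g b))]].

(* [a n P x u v] is the value at x, on the vectors u and v, of the pullback of
   the form by P; it is meaningful only when P is smooth near x. *)
Definition two_form_data (T : Type) :=
  forall n : nat, ('rV[R]_n -> T) -> 'rV[R]_n -> 'rV[R]_n -> 'rV[R]_n -> R.

Definition two_form (T : Type) (X : plots T) (a : two_form_data T) : Prop :=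
  [/\ (forall n (P : 'rV[R]_n -> T) x, X n P x ->
         (forall c u1 u2 v,
            a n P x (c *: u1 + u2) v = c * a n P x u1 v + a n P x u2 v) /\
         (forall u, a n P x u u = 0)),
      (forall n (P : 'rV[R]_n -> T) x u v, X n P x ->
         smooth_near (fun y => a n P y u v) x)
    & (forall n m (P : 'rV[R]_m -> T) (Q : 'rV[R]_n -> T)
          (phi : 'rV[R]_n -> 'rV[R]_m) y u v,
         rsmooth_near phi y -> X m P (phi y) ->
         (\forall z \near y, Q z = P (phi z)) ->
         a n Q y u v = a m P (phi y) (rvelocity phi y u) (rvelocity phi y v))].

Definition pullback (T T' : Type) (f : T -> T') (a : two_form_data T') :
  two_form_data T := fun n P => a n (f \o P).

Definition scale_form (T : Type) (c : R) (a : two_form_data T) :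
  two_form_data T := fun n P x u v => c * a n P x u v.

Definition eq_form (T : Type) (X : plots T) (a b : two_form_data T) : Prop :=
  forall n (P : 'rV[R]_n -> T) x u v, X n P x -> a n P x u v = b n P x u v.

End Structures.

Section Projective.
Context {R : realType}.

Definition dotr m (a b : 'rV[R]_m) : R := \sum_j a 0 j * b 0 j.
Definition re_part m (z : 'rV[R[i]]_m) : 'rV[R]_m := map_mx (@complex.Re R) z.
Definition im_part m (z : 'rV[R[i]]_m) : 'rV[R]_m := map_mx (@complex.Im R) z.
Definition sqnorm m (z : 'rV[R[i]]_m) : R :=
  dotr (re_part z) (re_part z) + dotr (im_part z) (im_part z).

(* omega_std = \sum_j dx_j /\ dy_j, with z_j = x_j + i y_j *)
Definition omega_std m (v w : 'rV[R[i]]_m) : R :=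
  dotr (re_part v) (im_part w) - dotr (im_part v) (re_part w).

(* [z_0 : ... : z_m], as the set of its homogeneous coordinates *)
Definition hcoord m (z : 'rV[R[i]]_m.+1) : set 'rV[R[i]]_m.+1 :=
  [set w | exists2 c : R[i], c != 0 & w = c *: z].

Definition CP (m : nat) : set (set 'rV[R[i]]_m.+1) :=
  [set hcoord z | z in [set z | z != 0]].

Definition CP_plots (m : nat) : plots (set 'rV[R[i]]_m.+1) :=
  fun n P x => exists L : 'rV[R]_n -> 'rV[R[i]]_m.+1,
    vsmooth_near L x /\ \forall y \near x, L y != 0 /\ P y = hcoord (L y).

(* rho^2 pr_rho^* omega = omega_std on S^{2m+1}(rho), tested on all smooth maps
   into the sphere *)
Definition fubini_study (m : nat) (omega : two_form_data (set 'rV[R[i]]_m.+1)) :=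
  two_form (@CP_plots m) omega /\
  forall rho : R, 0 < rho ->
  forall n (L : 'rV[R]_n -> 'rV[R[i]]_m.+1) x u v,
    vsmooth_near L x -> (\forall y \near x, sqnorm (L y) = rho ^+ 2) ->
    rho ^+ 2 * omega n (fun y => hcoord (L y)) x u v =
    omega_std (velocity L x u) (velocity L x v).

Definition RP2 : set (set 'rV[R[i]]_3) :=
  [set hcoord z | z in [set z : 'rV[R[i]]_3 | z != 0 /\ im_part z = 0]].

Definition Q1 : set (set 'rV[R[i]]_3) :=
  [set hcoord z | z in
     [set z : 'rV[R[i]]_3 | z != 0 /\ \sum_j z 0 j ^+ 2 = 0]].

End Projective.

Arguments CP {R} m.
Arguments CP_plots {R} m.

Section Cotangent.
Context {R : realType}.
Local Notation C3 := 'rV[R[i]]_3.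

(* p = re_part z and q = im_part z *)
Definition TS2 : set C3 :=
  [set z | dotr (re_part z) (re_part z) = 1 /\ dotr (re_part z) (im_part z) = 0].

Definition normq (z : C3) : R := Num.sqrt (dotr (im_part z) (im_part z)).

Definition U1S2 : set C3 := [set z | TS2 z /\ normq z < 1].
Definition D1S2 : set C3 := [set z | TS2 z /\ normq z <= 1].

(* the class of z in T^*RP^2 *)
Definition antip (z : C3) : set C3 := [set z; - z].

Definition U1RP2 : set (set C3) := [set antip z | z in U1S2].

(* the tangent space at z of the submanifold TS2 of C^3 *)
Definition tangentTS2 (z v : C3) : Prop :=
  dotr (re_part z) (re_part v) = 0 /\
  dotr (re_part v) (im_part z) + dotr (re_part z) (im_part v) = 0.

(* Integral curves of the Hamiltonian vector field X of H = |q|^2 / 2 on TS2,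
   characterized by omega_std(X, v) = dH(v) for v tangent to TS2, where
   dH(v) = <q, im_part v>.  The opposite sign convention only reverses time. *)
Definition hamiltonian_curve (gamma : R -> C3) : Prop :=
  forall t : R,
    [/\ TS2 (gamma t),
        (forall j, derivable (fun s => complex.Re (gamma s 0 j)) t 1 /\
                   derivable (fun s => complex.Im (gamma s 0 j)) t 1)
      & forall v, tangentTS2 (gamma t) v ->
          omega_std (velocity gamma t 1) v =
          dotr (im_part (gamma t)) (im_part v)].

(* the co-geodesic flow at time t sends z to w *)
Definition cogeodesic (t : R) (z w : C3) : Prop :=
  exists gamma, [/\ hamiltonian_curve gamma, gamma 0 = z & gamma t = w].

(* A point of the cut is a point of the open disc bundle or, on the boundary,
   the union of an orbit of the co-geodesic flow of T^*RP^2. *)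
Definition cut_class (z : C3) : set C3 :=
  antip z `|`
  [set w | normq z = 1 /\ exists t z', cogeodesic t z z' /\ antip z' w].

Definition cut : set (set C3) := [set cut_class z | z in D1S2].

(* On {q <> 0} in T^*RP^2, the Hamiltonian mu = |q| / 2 generates a free
   circle action with the orbits of the co-geodesic flow: s in R / 2 pi Z acts
   as the co-geodesic flow at time s / (2 |q|).  (The geodesics of RP^2 have
   length pi.)  The symplectic cut along {|q| = 1} is, near Q = {|q| = 1}/S^1,
   the symplectic reduction of {q <> 0} x C by the diagonal circle action with
   moment map mu + |w|^2 / 2 at the level 1/2, that is, the quotient of
   {(z, w) : |q| + |w|^2 = 1} by s.(z, w) = (s.z, e^{-is} w); the class of
   (z, w) with w > 0 is identified with the point z of U_1^*RP^2.
   [cut_reduce z w c] says that c is the class of (z, w): one uses the action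
   to make w nonnegative. *)
Definition cut_reduce (z : C3) (w : R[i]) (c : set C3) : Prop :=
  exists s z', [/\ 0 <= (cos s +i* - sin s)%C * w,
                   cogeodesic (s / (2 * normq z)) z z' & c = cut_class z'].

Definition cut_plots : plots (set C3) := fun n P x =>
  (exists L : 'rV[R]_n -> C3, vsmooth_near L x /\
     \forall y \near x, U1S2 (L y) /\ P y = cut_class (L y)) \/
  (exists (L : 'rV[R]_n -> C3) (w : 'rV[R]_n -> R[i]),
     [/\ vsmooth_near L x, csmooth_near w x
       & \forall y \near x,
           [/\ TS2 (L y), 0 < normq (L y),
               normq (L y) + (complex.Re (w y) ^+ 2 + complex.Im (w y) ^+ 2) = 1
             & cut_reduce (L y) (w y) (P y)]]).

(* The form on U_1^*RP^2 pulls back to omega_std on U_1^*S^2, so a 2-form on the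
   cut extends it iff it satisfies the equation below on all smooth maps into
   U_1^*S^2.  As U_1^*RP^2 is dense in the cut, such a form is unique. *)
Definition cut_form (omega : two_form_data (set C3)) : Prop :=
  two_form cut_plots omega /\
  forall n (L : 'rV[R]_n -> C3) x u v,
    vsmooth_near L x -> (\forall y \near x, U1S2 (L y)) ->
    omega n (fun y => cut_class (L y)) x u v =
    omega_std (velocity L x u) (velocity L x v).

(* iota' ([p + iq]) = [p + iq] *)
Definition iota' (c : set C3) : set C3 := \bigcup_(z in c) hcoord z.

Lemma iota'E (z : C3) : iota' (antip z) = hcoord z.
Proof.
apply/seteqP; split => [w [z' [->|->] //]|w zw]; last by exists z => //; left.
move=> -[c c0 ->]; exists (- c); first by rewrite oppr_eq0.
by rewrite scaleNr scalerN.
Qed.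

Lemma cut_class_interior (z : C3) : U1S2 z -> cut_class z = antip z.
Proof.
move=> -[_ z1]; apply/seteqP; split => [w|w zw]; last by left.
by move=> [//|/= [z1E _]]; rewrite z1E ltxx in z1.
Qed.

Lemma U1RP2_sub_cut : U1RP2 `<=` cut.
Proof.
move=> _ [z zU <-]; exists z; last exact: cut_class_interior.
by case: zU => ? /ltW.
Qed.

End Cotangent.

(* The smooth structure A of CP^2 for which "iota' extends to a diffeomorphism
   Phi from the cut to CP^2".  It is a parameter because, for the usual
   structure [CP_plots] of CP^2, the extension of iota' is a homeomorphism but
   not a diffeomorphism: near Q^1, the transverse coordinate w of the cut
   satisfies |w|^2 = 1 - |q|, whereas (z_0^2 + z_1^2 + z_2^2) / z_k^2, which
   vanishes transversely along Q^1 in the chart z_k <> 0 of CP^2, has absolute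
   value (1 - |q|^2) / |z_k|^2.  The case A = CP_plots of the theorem is thus the
   literal but vacuous reading.  As Phi is bijective, A is always the structure
   transported from the cut by Phi; on CP^2 - Q^1 it is the usual one. *)
Definition cut_identification (R : realType) (A : plots (set 'rV[R[i]]_3))
    (Phi : set 'rV[R[i]]_3 -> set 'rV[R[i]]_3) : Prop :=
  [/\ smooth_structure (CP 2) A,
      diffeomorphism cut cut_plots (CP 2) A Phi
    & forall c, U1RP2 c -> Phi c = iota' c].

(* Main.v *)
Require Import Defs.
From HB Require Import structures.
From mathcomp Require Import all_boot all_order all_algebra.
From mathcomp Require Import all_classical all_reals all_analysis.
From mathcomp Require Import complex ring lra.

(** The idea is to map the cut to the projective plane by an explicit map, other
    than [iota'].  On the disc bundle it sends [p + i q] to the class of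
    [a p + i q / a].  For any positive function [a] the map
    [p + i q |-> a p + i q / a] pulls [omega_std] back to itself on the cotangent
    bundle, because the pullback of the Liouville form [<q, dp>] by it is that form
    ([omega_std_sphere_point]).  For [a^2 = 1 + sqrt (1 - |q|^2)] the image has
    square norm 2, so that [omega_std] is the pullback of [2 omega_FS] to it; hence
    the map on the open disc bundle pulls [2 omega_FS] back to the form of the cut.

    The factor [a] is not smooth at the boundary [|q| = 1], but the map of the cut
    is.  For [z = p + i q], [t = |q|] and [e = q / t], the vector [a p + i q / a] is
    proportional to
    [sqrt (1 + t) (p + i e) + sqrt (1 - t) (p - i e)],
    and the normalized co-geodesic flow, which turns the plane of [p] and [e],
    multiplies [p + i e] and [p - i e] by inverse phases.  Therefore
    [(z, w) |-> sqrt (1 + t) (p + i e) + w (p - i e)], on the pairs with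
    [t + |w|^2 = 1], changes only by a phase under the circle action that defines
    the cut ([cut_reduce_to_CP]), and it is smooth for [t > 0].  It can be solved
    for [p], [q] and [w] smoothly: the bilinear square [Z . Z] of the image is
    [4 sqrt (1 + t) w], which gives [t] and [w], and then [p + i e] is a combination
    of [Z] and its conjugate ([reduction_point_solve]).  Where [Z . Z] is not zero
    one can instead make it positive by a change of phase and read off [p] and [q]
    from the real and imaginary parts ([lift_interior]).  So the map is a
    diffeomorphism from the cut to the projective plane with its usual structure.
    It takes the form of the cut to [2 omega_FS] off the quadric
    ([cut_form_off_Q1]), hence everywhere by continuity ([cut_formE]).

    The diffeomorphism of the theorem is the composite of this map with the inverse
    of the identification of the cut with the projective plane.  It fixes the real
    points, since [iota'] and the explicit map agree on the zero section.  It
    preserves the quadric, since both maps send precisely the boundary classes of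
    the cut to the quadric ([Q1_identification], [Q1_cut_to_CP]).

    Smoothness is defined through iterated directional derivatives, so everything
    that is shown to be smooth is written in terms of sums, products, inverses and
    square roots of smooth functions. *)

Import Defs.
Set Implicit Arguments.
Unset Strict Implicit.
Unset Printing Implicit Defensive.
Import Order.TTheory GRing.Theory Num.Theory numFieldNormedType.Exports.
Local Open Scope classical_set_scope.
Local Open Scope ring_scope.

(** * Smooth functions *)

Section SmoothFunctions.
Context {R : realType} {E : normedModType R}.
Implicit Types (f g : E -> R) (x v : E) (U : set E).

Lemma derivable_sqrt f x v : 0 < f x -> derivable f x v ->
  derivable (fun y => Num.sqrt (f y)) x v /\
  'D_v (fun y => Num.sqrt (f y)) x = 2^-1 * ((Num.sqrt (f x))^-1 * 'D_v f x).
Proof.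
move=> fx df.
pose g := fun h : R => f (h *: v + x).
have g0 : g 0 = f x by rewrite /g scale0r add0r.
have D1 (k : E -> R) : 'D_(1 : R) (fun h : R => k (h *: v + x)) (0 : R) = 'D_v k x.
  rewrite /derive; set g1 := fun h => h^-1 *: _; set g2 := fun h => h^-1 *: _.
  suff -> : g1 = g2 by [].
  by apply: funext => h; rewrite /g1 /g2 /= addr0 scale0r add0r [_%:A]mulr1.
have dg : is_derive (0 : R) (1 : R) g ('D_v f x).
  split; first by move/derivable1P: df.
  exact: D1.
have ds : is_derive (g 0) (1 : R) Num.sqrt (2 * Num.sqrt (g 0))^-1.
  by apply: is_derive1_sqrt; rewrite g0.
have [d1 d2] := is_derive1_comp ds dg.
split; first by apply/derivable1P.
transitivity ('D_(1 : R) (Num.sqrt \o g) (0 : R)).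
  exact/esym/(D1 (fun y => Num.sqrt (f y))).
by rewrite d2 g0 invfM mulrA.
Qed.

Lemma Ck_on_continuous k U f x : Ck_on k U f -> U x -> {for x, continuous f}.
Proof. by case: k => [|k] [+ _] => /[apply]. Qed.

Lemma Ck_on_derivable k U f x v : Ck_on k.+1 U f -> U x -> derivable f x v.
Proof. by case=> _ /(_ v)[+ _] => /[apply]. Qed.

Lemma Ck_onS k U f : Ck_on k.+1 U f -> Ck_on k U f.
Proof.
elim: k f => [|k IH] f [cf df]; split=> // v.
by have [? /IH ?] := df v; split.
Qed.

Lemma Ck_on_sub k U V f : V `<=` U -> Ck_on k U f -> Ck_on k V f.
Proof.
move=> VU; elim: k f => [|k IH] f [cf df]; split=> //; first by move=> x /VU/cf.
  by move=> x /VU/cf.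
move=> v.
by have [d /IH ?] := df v; split=> // x /VU/d.
Qed.

Lemma continuous_near_eq f g x : (\forall y \near x, f y = g y) ->
  {for x, continuous f} -> {for x, continuous g}.
Proof.
rewrite /prop_for /continuous_at => fg cf; rewrite -(nbhs_singleton fg).
by apply: cvg_trans cf; exact: near_eq_cvg.
Qed.

Lemma Ck_on_ext k U f g : open U -> (forall x, U x -> f x = g x) ->
  Ck_on k U f -> Ck_on k U g.
Proof.
move=> oU; elim: k f g => [|k IH] f g fg [cf df].
all: have nfg x : U x -> \forall y \near x, f y = g y
  by move=> Ux; near=> y; apply: fg; near: y; exact: open_nbhs_nbhs.
  by split=> // x Ux; exact: continuous_near_eq (nfg _ Ux) (cf x Ux).
split=> [x Ux|v]; first exact: continuous_near_eq (nfg _ Ux) (cf x Ux).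
have [d D] := df v; split=> [x Ux|].
  exact: near_eq_derivable (nfg _ Ux) (d x Ux).
by apply: IH D => x Ux; apply: near_eq_derive; exact: nfg.
Unshelve. all: by end_near. Qed.

Lemma Ck_on_cst k U (a : R) : open U -> Ck_on k U (cst a : E -> R).
Proof.
move=> oU; elim: k a => [|k IH] a; split=> //; try by move=> x _; exact: cst_continuous.
move=> v; 
split=> [x _|]; first exact: derivable_cst.
by apply: Ck_on_ext (IH 0) => // x Ux; rewrite derive_cst.
Qed.

Lemma Ck_on_add k U f g : open U ->
  Ck_on k U f -> Ck_on k U g -> Ck_on k U (fun x => f x + g x).
Proof.
move=> oU; elim: k f g => [|k IH] f g [cf df] [cg dg].
  by split=> // x Ux; apply: cvgD; [exact: cf|exact: cg].
split=> [x Ux|v]; first by apply: cvgD; [exact: cf|exact: cg].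
have [d1 D1] := df v; have [d2 D2] := dg v; split=> [x Ux|].
  by apply: derivableD; [exact: d1|exact: d2].
by apply: Ck_on_ext (IH _ _ D1 D2) => // x Ux; rewrite deriveD//; auto.
Qed.

Lemma Ck_on_mul k U f g : open U ->
  Ck_on k U f -> Ck_on k U g -> Ck_on k U (fun x => f x * g x).
Proof.
move=> oU; elim: k f g => [|k IH] f g.
  by move=> [cf df] [cg dg]; split=> // x Ux; apply: cvgM; [exact: cf|exact: cg].
move=> Cf Cg; have [cf df] := Cf; have [cg dg] := Cg.
split=> [x Ux|v]; first by apply: cvgM; [exact: cf|exact: cg].
have [d1 D1] := df v; have [d2 D2] := dg v; split=> [x Ux|].
  by apply: derivableM; [exact: d1|exact: d2].
apply: Ck_on_ext (Ck_on_add oU (IH _ _ (Ck_onS Cf) D2)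
  (IH _ _ (Ck_onS Cg) D1)) => // x Ux.
by rewrite deriveM//; auto.
Qed.

(** The derivatives of [f^-1] and of [sqrt f] are products of ['D_v f] with
    powers of the same functions, so that the order of differentiability goes up
    one by one. *)
Lemma Ck_on_inv k U f : open U -> (forall x, U x -> f x != 0) ->
  Ck_on k U f -> Ck_on k U (fun x => (f x)^-1).
Proof.
move=> oU f0; elim: k => [|k IH] Cf.
  by split=> // x Ux; apply: cvgV; [exact: f0|exact: (Ck_on_continuous Cf)].
split=> [x Ux|v].
  by apply: cvgV; [exact: f0|exact: (Ck_on_continuous Cf)].
have [_ /(_ v)[d D]] := Cf; split=> [x Ux|].
  by apply: derivableV; [exact: f0|exact: d].
have Ci := IH (Ck_onS Cf).
apply: Ck_on_ext (Ck_on_mul oU (Ck_on_mul oU (Ck_on_cst k (-1) oU)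
  (Ck_on_mul oU Ci Ci)) D) => // x Ux.
rewrite deriveV//; [|exact: f0|exact: d].
by rewrite /cst /= mulN1r /GRing.scale /= -expr2 exprVn.
Qed.

Lemma Ck_on_sqrt k U f : open U -> (forall x, U x -> 0 < f x) ->
  Ck_on k U f -> Ck_on k U (fun x => Num.sqrt (f x)).
Proof.
move=> oU f0; elim: k => [|k IH] Cf.
  split=> // x Ux; apply: continuous_comp; first exact: (Ck_on_continuous Cf).
  exact: sqrt_continuous.
split=> [x Ux|v].
  apply: continuous_comp; first exact: (Ck_on_continuous Cf).
  exact: sqrt_continuous.
have [_ /(_ v)[d D]] := Cf; split=> [x Ux|].
  by have [] := derivable_sqrt (f0 x Ux) (d x Ux).
have Ci : Ck_on k U (fun x => (Num.sqrt (f x))^-1).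
  apply: (Ck_on_inv oU) (IH (Ck_onS Cf)) => x Ux.
  by rewrite gt_eqF// sqrtr_gt0 f0.
apply: Ck_on_ext (Ck_on_mul oU (Ck_on_cst k 2^-1 oU) (Ck_on_mul oU Ci D)) => //.
by move=> x Ux; have [_ ->] := derivable_sqrt (f0 x Ux) (d x Ux).
Qed.

Lemma smooth_near_near f x :
  smooth_near f x -> \forall y \near x, smooth_near f y.
Proof.
move=> [U [oU Ux Cf]]; near=> y; exists U; split=> //.
by near: y; exact: open_nbhs_nbhs.
Unshelve. all: by end_near. Qed.

Lemma smooth_near_continuous f x : smooth_near f x -> {for x, continuous f}.
Proof. by move=> [U [oU Ux Cf]]; exact: (Ck_on_continuous (Cf 0%N)). Qed.

Lemma smooth_near_derivable f x v : smooth_near f x -> derivable f x v.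
Proof. by move=> [U [oU Ux Cf]]; exact: (Ck_on_derivable (Cf 1%N) Ux). Qed.

Lemma smooth_near_ext f g x : (\forall y \near x, f y = g y) ->
  smooth_near f x -> smooth_near g x.
Proof.
move=> fg [U [oU Ux Cf]]; exists (U `&` [set y | f y = g y]^°); split.
- by apply: openI => //; exact: open_interior.
- by split.
- move=> k; apply: (@Ck_on_ext _ _ f).
  + by apply: openI => //; exact: open_interior.
  + by move=> y [_ /interior_subset].
  + by apply: Ck_on_sub (Cf k) => y [].
Qed.

Lemma smooth_near_cst (a : R) x : smooth_near (fun=> a) x.
Proof.
by exists setT; split=> // [|k]; [exact: openT|exact: Ck_on_cst openT].
Qed.

Lemma smooth_near_add f g x :
  smooth_near f x -> smooth_near g x -> smooth_near (fun y => f y + g y) x.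
Proof.
move=> [U [oU Ux Cf]] [V [oV Vx Cg]]; exists (U `&` V); split=> //.
  exact: openI.
move=> k; apply: (Ck_on_add (openI oU oV)).
  by apply: Ck_on_sub (Cf k) => y [].
by apply: Ck_on_sub (Cg k) => y [].
Qed.

Lemma smooth_near_mul f g x :
  smooth_near f x -> smooth_near g x -> smooth_near (fun y => f y * g y) x.
Proof.
move=> [U [oU Ux Cf]] [V [oV Vx Cg]]; exists (U `&` V); split=> //.
  exact: openI.
move=> k; apply: (Ck_on_mul (openI oU oV)).
  by apply: Ck_on_sub (Cf k) => y [].
by apply: Ck_on_sub (Cg k) => y [].
Qed.

Lemma smooth_near_opp f x : smooth_near f x -> smooth_near (fun y => - f y) x.
Proof.
move=> sf; apply: smooth_near_ext (smooth_near_mul (smooth_near_cst (-1) x) sf).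
by near=> y; rewrite mulN1r.
Unshelve. all: by end_near. Qed.

Lemma smooth_near_sub f g x :
  smooth_near f x -> smooth_near g x -> smooth_near (fun y => f y - g y) x.
Proof. by move=> sf sg; apply: smooth_near_add sf (smooth_near_opp sg). Qed.

Lemma smooth_near_sqr f x :
  smooth_near f x -> smooth_near (fun y => f y ^+ 2) x.
Proof. by move=> sf; exact: smooth_near_mul. Qed.

Lemma smooth_near_sum (I : Type) (r : seq I) (F : I -> E -> R) x :
  (forall i, smooth_near (F i) x) -> smooth_near (fun y => \sum_(i <- r) F i y) x.
Proof.
move=> sF; elim: r => [|i r IH].
  apply: smooth_near_ext (smooth_near_cst 0 x).
  by near=> y; rewrite big_nil.
apply: smooth_near_ext (smooth_near_add (sF i) IH).
by near=> y; rewrite big_cons.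
Unshelve. all: by end_near. Qed.

(** Continuity of [f] allows one to shrink the neighbourhood to one on which the
    condition [P] on its value, needed by the operation, holds throughout. *)
Lemma smooth_near_open f x (P : set R) : open P -> P (f x) -> smooth_near f x ->
  exists U, [/\ open U, U x, (forall y, U y -> P (f y)) & forall k, Ck_on k U f].
Proof.
move=> oP Px [U [oU Ux Cf]]; exists (U `&` [set y | P (f y)]^°); split.
- by apply: openI => //; exact: open_interior.
- split=> //.
  by apply: (Ck_on_continuous (Cf 0%N) Ux); exact: open_nbhs_nbhs.
- by move=> y [_ /interior_subset].
- by move=> k; apply: Ck_on_sub (Cf k) => y [].
Qed.

Lemma smooth_near_inv f x : f x != 0 -> smooth_near f x ->
  smooth_near (fun y => (f y)^-1) x.
Proof.
move=> fx /(smooth_near_open (@open_neq _ 0) fx)[U [oU Ux f0 Cf]].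
by exists U; split=> // k; exact: Ck_on_inv.
Qed.

Lemma smooth_near_div f g x : g x != 0 -> smooth_near f x -> smooth_near g x ->
  smooth_near (fun y => f y / g y) x.
Proof. by move=> gx sf sg; apply: smooth_near_mul sf (smooth_near_inv gx sg). Qed.

Lemma smooth_near_sqrt f x : 0 < f x -> smooth_near f x ->
  smooth_near (fun y => Num.sqrt (f y)) x.
Proof.
move=> fx /(smooth_near_open (@open_gt _ 0) fx)[U [oU Ux f0 Cf]].
by exists U; split=> // k; exact: Ck_on_sqrt.
Qed.

Lemma smooth_near_linear_form (f : {linear E -> R}) x :
  continuous f -> smooth_near f x.
Proof.
move=> cf; exists setT; split=> //; first exact: openT.
have df (y v : E) : (fun h : R => h^-1 *: ((f \o shift y) (h *: v) - f y)) @ 0^'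
    --> f v.
  apply: cvg_near_cst; near=> h => /=.
  rewrite (linearD f) (linearZ_LR f) addrK /GRing.scale /= mulrA mulVf ?mul1r//.
  by near: h; exact: nbhs_dnbhs_neq.
elim=> [|k IH]; split=> //; try by move=> y _; exact: cf.
move=> v.
split=> [y _|]; first by apply/cvg_ex; exists (f v); exact: df.
apply: (@Ck_on_ext _ _ (cst (f v))) => //; first exact: openT.
  by move=> y _; rewrite /derive (cvg_lim _ (df y v)).
exact/Ck_on_cst/openT.
Unshelve. all: by end_near. Qed.

End SmoothFunctions.

Section LinearSource.
Context {R : realType} {E E' : normedModType R}.
Context (l : {linear E -> E'}) (cl : continuous l).

Lemma Ck_on_linear k (U : set E') (f : E' -> R) :
  Ck_on k U f -> Ck_on k (l @^-1` U) (f \o l).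
Proof.
have D (g : E' -> R) x v : (fun h : R => h^-1 *: ((g \o l \o shift x) (h *: v) - (g \o l) x)) =
    (fun h => h^-1 *: ((g \o shift (l x)) (h *: l v) - g (l x))).
  by apply: funext => h /=; rewrite (linearD l) (linearZ_LR l).
elim: k f => [|k IH] f [cf df].
  by split=> // x Ux; apply: continuous_comp; [exact: cl|exact: cf].
split=> [x Ux|v]; first by apply: continuous_comp; [exact: cl|exact: cf].
have [d C] := df (l v); split=> [x Ux|].
  by have := d _ Ux; rewrite /derivable D.
rewrite (_ : (fun x => _) = (fun y => 'D_(l v) f y) \o l); first exact: IH.
by apply: funext => x; rewrite /derive D.
Qed.

Lemma smooth_near_linear (f : E' -> R) x :
  smooth_near f (l x) -> smooth_near (f \o l) x.
Proof.
move=> [U [oU Ux Cf]]; exists (l @^-1` U); split=> // [|k].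
  by apply: open_comp => // y _; exact: cl.
exact: Ck_on_linear.
Qed.

End LinearSource.

(** * Complex vectors as pairs of real vectors *)

Section Vectors.
Context {R : realType} {m : nat}.
Implicit Types (p q u v : 'rV[R]_m) (a b : R) (z w : 'rV[R[i]]_m).

Lemma dotrC p q : dotr p q = dotr q p.
Proof. by apply: eq_bigr => j _; rewrite mulrC. Qed.

Lemma dotrDl p q u : dotr (p + q) u = dotr p u + dotr q u.
Proof.
by rewrite -big_split; apply: eq_bigr => j _; rewrite mxE mulrDl.
Qed.

Lemma dotrDr p q u : dotr u (p + q) = dotr u p + dotr u q.
Proof. by rewrite !(dotrC u) dotrDl. Qed.

Lemma dotrZl a p u : dotr (a *: p) u = a * dotr p u.
Proof. by rewrite mulr_sumr; apply: eq_bigr => j _; rewrite mxE mulrA. Qed.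

Lemma dotrZr a p u : dotr u (a *: p) = a * dotr u p.
Proof. by rewrite !(dotrC u) dotrZl. Qed.

Lemma dotrNl p u : dotr (- p) u = - dotr p u.
Proof. by rewrite -scaleN1r dotrZl mulN1r. Qed.

Lemma dotrNr p u : dotr u (- p) = - dotr u p.
Proof. by rewrite !(dotrC u) dotrNl. Qed.

Lemma dotr0l p : dotr 0 p = 0.
Proof. by rewrite -(scale0r 0) dotrZl mul0r. Qed.

Lemma dotr0r p : dotr p 0 = 0.
Proof. by rewrite dotrC dotr0l. Qed.

Definition dotrE := (dotrDl, dotrDr, dotrNl, dotrNr, dotrZl, dotrZr,
  dotr0l, dotr0r).

Lemma dotr_ge0 p : 0 <= dotr p p.
Proof. by apply: sumr_ge0 => j _; rewrite -expr2 sqr_ge0. Qed.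

Lemma dotr_eq0 p : (dotr p p == 0) = (p == 0).
Proof.
apply/eqP/eqP => [p0|->]; last by rewrite dotr0l.
apply/rowP => j; rewrite mxE; apply/eqP; rewrite -sqrf_eq0 expr2.
have /(_ j isT) : forall i, true -> p 0 i * p 0 i = 0.
  apply/psumr_eq0P => [i _|]; first by rewrite -expr2 sqr_ge0.
  exact: p0.
by move=> ->.
Qed.

Lemma dotr_gt0 p : (0 < dotr p p) = (p != 0).
Proof. by rewrite lt_neqAle dotr_ge0 andbT eq_sym dotr_eq0. Qed.

Definition cvec p q : 'rV[R[i]]_m := \row_j (p 0 j +i* q 0 j)%C.

Lemma re_cvec p q : re_part (cvec p q) = p.
Proof. by apply/rowP => j; rewrite !mxE. Qed.

Lemma im_cvec p q : im_part (cvec p q) = q.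
Proof. by apply/rowP => j; rewrite !mxE. Qed.

Lemma cvecK z : cvec (re_part z) (im_part z) = z.
Proof. by apply/rowP => j; rewrite !mxE; case: (z 0 j). Qed.

Lemma cvecP z : exists p q, z = cvec p q.
Proof. by exists (re_part z), (im_part z); rewrite cvecK. Qed.

Lemma scale_cvec a b p q :
  (a +i* b)%C *: cvec p q = cvec (a *: p - b *: q) (a *: q + b *: p).
Proof. by apply/rowP => j; rewrite !mxE. Qed.

Lemma opp_cvec p q : - cvec p q = cvec (- p) (- q).
Proof. by apply/rowP => j; rewrite !mxE. Qed.

Lemma cvec_eq0 p q : (cvec p q == 0) = (p == 0) && (q == 0).
Proof.
apply/eqP/andP => [z0|[/eqP-> /eqP->]]; last by apply/rowP => j; rewrite !mxE.
split; apply/eqP.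
- by rewrite -(re_cvec p q) z0; apply/rowP => j; rewrite !mxE.
- by rewrite -(im_cvec p q) z0; apply/rowP => j; rewrite !mxE.
Qed.

Lemma cvec_inj p q p' q' : cvec p q = cvec p' q' -> p = p' /\ q = q'.
Proof.
by move=> e; rewrite -(re_cvec p q) -[in X in _ /\ X](im_cvec p q) e re_cvec im_cvec.
Qed.

Lemma sqnorm_cvec p q : sqnorm (cvec p q) = dotr p p + dotr q q.
Proof. by rewrite /sqnorm re_cvec im_cvec. Qed.

Lemma sqnorm_gt0 z : (0 < sqnorm z) = (z != 0).
Proof.
have [p [q ->]] := cvecP z; rewrite sqnorm_cvec cvec_eq0 negb_and -!dotr_gt0.
rewrite !lt_neqAle !dotr_ge0 addr_ge0 ?dotr_ge0// !andbT.
by rewrite [0 == _ + _]eq_sym paddr_eq0 ?dotr_ge0// negb_and ![_ == 0]eq_sym.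
Qed.

Lemma omega_std_cvec p q u v :
  omega_std (cvec p q) (cvec u v) = dotr p v - dotr q u.
Proof. by rewrite /omega_std !re_cvec !im_cvec. Qed.

End Vectors.

Section DerivativeOfProducts.
Context {R : realType} {E : normedModType R} {m : nat}.
Implicit Types (x u : E).

Lemma is_derive_dotr (P Q : E -> 'rV[R]_m) x u (dP dQ : 'rV[R]_m) :
  (forall j, is_derive x u (fun y => P y 0 j) (dP 0 j)) ->
  (forall j, is_derive x u (fun y => Q y 0 j) (dQ 0 j)) ->
  is_derive x u (fun y => dotr (P y) (Q y)) (dotr (P x) dQ + dotr dP (Q x)).
Proof.
move=> hP hQ.
rewrite (_ : (fun y => _) = \sum_j (fun y => P y 0 j * Q y 0 j)); last first.
  by apply: funext => y; rewrite fct_sumE.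
rewrite -big_split /=; apply: is_derive_sum => j.
have := @is_deriveM _ _ _ _ _ _ _ _ (hP j) (hQ j).
by rewrite /GRing.scale /= [X in _ + X]mulrC.
Qed.

Lemma is_derive_re (L : E -> 'rV[R[i]]_m) x u j :
  derivable (fun y => complex.Re (L y 0 j)) x u ->
  is_derive x u (fun y => re_part (L y) 0 j) (re_part (velocity L x u) 0 j).
Proof.
have -> : (fun y => re_part (L y) 0 j) = (fun y => complex.Re (L y 0 j)).
  by apply: funext => y; rewrite mxE.
by rewrite !mxE /= => /derivableP.
Qed.

Lemma is_derive_im (L : E -> 'rV[R[i]]_m) x u j :
  derivable (fun y => complex.Im (L y 0 j)) x u ->
  is_derive x u (fun y => im_part (L y) 0 j) (im_part (velocity L x u) 0 j).
Proof.
have -> : (fun y => im_part (L y) 0 j) = (fun y => complex.Im (L y 0 j)).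
  by apply: funext => y; rewrite mxE.
by rewrite !mxE /= => /derivableP.
Qed.

End DerivativeOfProducts.

Section Projective.
Context {R : realType} {m : nat}.
Implicit Types (z w : 'rV[R[i]]_m.+1) (c : R[i]).

Lemma hcoord_scale c z : c != 0 -> hcoord (c *: z) = hcoord z.
Proof.
move=> c0; apply/seteqP; split => w [d d0 ->].
  by exists (d * c); rewrite ?mulf_neq0// scalerA.
by exists (d / c); rewrite ?mulf_neq0 ?invr_eq0// scalerA divfK.
Qed.

Lemma hcoord_eq z w : hcoord z = hcoord w -> exists2 c, c != 0 & w = c *: z.
Proof.
move=> zw; have : hcoord w w by exists 1; rewrite ?oner_neq0 ?scale1r.
by rewrite -zw => -[c c0 ->]; exists c.
Qed.

Lemma hcoord_cvec_scale a (p q : 'rV[R]_m.+1) : a != 0 ->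
  hcoord (cvec (a *: p) (a *: q)) = hcoord (cvec p q).
Proof.
move=> a0; rewrite -(@hcoord_scale (a +i* 0)%C (cvec p q)).
  by rewrite scale_cvec !scale0r subr0 addr0.
by rewrite eq_complex /= negb_and a0.
Qed.

End Projective.

(** * The co-geodesic flow *)

Section Flow.
Context {R : realType}.
Local Notation C3 := 'rV[R[i]]_3.
Implicit Types (p q : 'rV[R]_3) (z w : C3) (t s : R).

Lemma TS2_cvec p q : TS2 (cvec p q) <-> dotr p p = 1 /\ dotr p q = 0.
Proof. by rewrite /TS2 /= re_cvec im_cvec. Qed.

Lemma normq_cvec p q : normq (cvec p q) = Num.sqrt (dotr q q).
Proof. by rewrite /normq im_cvec. Qed.

Lemma sqr_normq p q : normq (cvec p q) ^+ 2 = dotr q q.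
Proof. by rewrite normq_cvec sqr_sqrtr// dotr_ge0. Qed.

(** The co-geodesic flow at the time [th / |q|]: it turns the orthonormal pair
    [(p, q / |q|)] by the angle [th] in its plane. *)
Definition rotate (th : R) z : C3 :=
  let p := re_part z in let q := im_part z in let t := normq z in
  cvec (cos th *: p + (sin th / t) *: q) (cos th *: q - (t * sin th) *: p).

Lemma rotate_cvec th p q (t := normq (cvec p q)) : rotate th (cvec p q) =
  cvec (cos th *: p + (sin th / t) *: q) (cos th *: q - (t * sin th) *: p).
Proof. by rewrite /rotate re_cvec im_cvec. Qed.

Lemma rotate_TS2 th z : TS2 z -> 0 < normq z ->
  TS2 (rotate th z) /\ normq (rotate th z) = normq z.
Proof.
have [p [q ->]] := cvecP z; rewrite TS2_cvec rotate_cvec => -[pp pq] t0.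
have qq := sqr_normq p q; set t := normq _ in t0 qq *.
rewrite TS2_cvec normq_cvec !dotrE (dotrC q p) pp pq -qq.
have t1 : t != 0 by rewrite gt_eqF.
have cs := cos2Dsin2 th; split; first split.
- by rewrite -[RHS]cs; field.
- by field.
- rewrite -[RHS](ger0_norm (ltW t0)) -sqrtr_sqr; congr Num.sqrt.
  by transitivity (t ^+ 2 * (cos th ^+ 2 + sin th ^+ 2)); [ring|rewrite cs mulr1].
Qed.

(** Testing the Hamiltonian equation on the tangent vectors [(0, w)] and
    [(w, - <w, q> p)], for [w] orthogonal to [p], gives the components orthogonal
    to [p] of the two halves of the velocity; the components along [p] come from
    the equations of the cotangent bundle. *)
Lemma hamiltonian_ode (gamma : R -> C3) s (z := gamma s)
    (v := velocity gamma s 1) : hamiltonian_curve gamma ->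
  re_part v = im_part z /\ im_part v = - dotr (im_part z) (im_part z) *: re_part z.
Proof.
move=> H; have [TS D eqn] := H s.
have dre j : is_derive s 1 (fun y => re_part (gamma y) 0 j) (re_part v 0 j).
  by apply: is_derive_re; have [] := D j.
have dim j : is_derive s 1 (fun y => im_part (gamma y) 0 j) (im_part v 0 j).
  by apply: is_derive_im; have [] := D j.
have := is_derive_dotr dre dre.
rewrite (_ : (fun y => _) = cst 1); last first.
  by apply: funext => y; have [[]] := H y.
move=> [_]; rewrite derive_cst -/z => e1.
have := is_derive_dotr dre dim.
rewrite (_ : (fun y => _) = cst 0); last first.
  by apply: funext => y; have [[]] := H y.
move=> [_]; rewrite derive_cst -/z => e2.
move: TS eqn e1 e2; rewrite -/v -/z.
rewrite -(cvecK v) -(cvecK z) !re_cvec !im_cvec.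
set p := re_part z; set q := im_part z; set dp := re_part v; set dq := im_part v.
rewrite TS2_cvec /tangentTS2 re_cvec im_cvec => -[pp pq] eqn.
rewrite (dotrC dp p) => e1; have {}e1 : dotr p dp = 0 by lra.
move=> e2.
have dpE : dp = q.
  apply/eqP; rewrite -subr_eq0 -dotr_eq0.
  have := eqn (cvec 0 (dp - q)).
  rewrite re_cvec im_cvec omega_std_cvec !dotrE e1 pq !subr0 addr0 => /(_ (conj erefl erefl)).
  by rewrite (dotrC q dp) => h; apply/eqP; lra.
split=> //.
have pdq : dotr p dq = - dotr q q by move: e2; rewrite dpE; lra.
have [w wE] : exists w : 'rV[R]_3, w = dq - dotr p dq *: p by eexists.
have pw : dotr p w = 0 by rewrite wE !dotrE pp mulr1 subrr.
have w0 : w = 0.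
  apply/eqP; rewrite -dotr_eq0.
  have := eqn (cvec w (- dotr w q *: p)).
  rewrite re_cvec im_cvec omega_std_cvec !dotrE (dotrC dp p) e1 (dotrC q p) pq pp pw.
  rewrite mulr1 subrr => /(_ (conj erefl erefl)); rewrite mulr0 sub0r => h.
  apply/eqP; transitivity (dotr dq w); last by lra.
  by rewrite {1}wE !dotrE pw mulr0 subr0.
by rewrite -pdq; apply/eqP; rewrite -subr_eq0 -wE w0.
Qed.

(** As [|q|] is constant along the curve, the equations [p' = q],
    [q' = - |q|^2 p] are linear with constant coefficients, and the inverse
    rotation, applied to the curve, has zero derivative. *)
Lemma hamiltonian_curveE (gamma : R -> C3) s (z := gamma 0) :
  hamiltonian_curve gamma -> 0 < normq z -> gamma s = rotate (normq z * s) z.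
Proof.
move=> H t0; set t := normq z in t0 *.
pose P (s : R) := re_part (gamma s); pose Q (s : R) := im_part (gamma s).
have dP (r : R) j : is_derive r (1 : R) (fun y => P y 0 j) (Q r 0 j).
  rewrite /P /Q; have [<- _] := hamiltonian_ode r H.
  by apply: is_derive_re; have [_ /(_ j)[]] := H r.
have dQ' (r : R) j : is_derive r (1 : R) (fun y => Q y 0 j) ((- dotr (Q r) (Q r) *: P r) 0 j).
  rewrite /P /Q; have [_ <-] := hamiltonian_ode r H.
  by apply: is_derive_im; have [_ /(_ j)[]] := H r.
have QQ r : dotr (Q r) (Q r) = t ^+ 2.
  rewrite /t -(cvecK z) sqr_normq.
  apply: (@is_derive_0_is_cst _ (fun r => dotr (Q r) (Q r))) => x.
  apply: is_derive_eq (is_derive_dotr (dQ' x) (dQ' x)) _.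
  have [[_ pq] _ _] := H x.
  by rewrite !dotrE (dotrC (Q x)) pq mulr0 addr0.
have dQ (r : R) j : is_derive r (1 : R) (fun y => Q y 0 j) (- t ^+ 2 * P r 0 j).
  by have := dQ' r j; rewrite QQ mxE.
have t1 : t != 0 by rewrite gt_eqF.
have dt (r : R) : is_derive r (1 : R) (fun y : R => t * y) t.
  have := is_deriveZ t (is_derive_id r (1 : R)).
  by rewrite /GRing.scale /= mulr1.
have dcos (r : R) : is_derive r (1 : R) (fun y => cos (t * y)) (- sin (t * r) * t).
  exact: (is_derive1_comp (is_derive_cos (t * r)) (dt r)).
have dsin (r : R) : is_derive r (1 : R) (fun y => sin (t * y)) (cos (t * r) * t).
  exact: (is_derive1_comp (is_derive_sin (t * r)) (dt r)).
have K1 j : t * (cos (t * s) * P s 0 j) - sin (t * s) * Q s 0 j = t * P 0 0 j.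
  have -> : t * P 0 0 j = t * (cos (t * 0) * P 0 0 j) - sin (t * 0) * Q 0 0 j.
    by rewrite mulr0 cos0 sin0 mul1r !mul0r subr0.
  apply: (@is_derive_0_is_cst _ (fun s =>
    t * (cos (t * s) * P s 0 j) - sin (t * s) * Q s 0 j)) => x.
  apply: (is_derive_eq (is_deriveB (is_deriveZ t (is_deriveM (dcos x) (dP x j)))
    (is_deriveM (dsin x) (dQ x j)))).
  by rewrite /GRing.scale /=; ring.
have K2 j : t * (sin (t * s) * P s 0 j) + cos (t * s) * Q s 0 j = Q 0 0 j.
  have -> : Q 0 0 j = t * (sin (t * 0) * P 0 0 j) + cos (t * 0) * Q 0 0 j.
    by rewrite mulr0 cos0 sin0 mul0r mulr0 add0r mul1r.
  apply: (@is_derive_0_is_cst _ (fun s =>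
    t * (sin (t * s) * P s 0 j) + cos (t * s) * Q s 0 j)) => x.
  apply: (is_derive_eq (is_deriveD (is_deriveZ t (is_deriveM (dsin x) (dP x j)))
    (is_deriveM (dcos x) (dQ x j)))).
  by rewrite /GRing.scale /=; ring.
rewrite -[LHS]cvecK /rotate -/t -/(P s) -/(Q s) -/(P 0) -/(Q 0).
have cs := cos2Dsin2 (t * s).
move: (P s) (P 0) (Q s) (Q 0) K1 K2 => ps p0 qs q0 K1 K2.
congr cvec; apply/rowP => j; rewrite !mxE.
- apply: (mulfI t1); rewrite -[LHS]mul1r -cs.
  transitivity (cos (t * s) * (t * p0 0 j) + sin (t * s) * q0 0 j).
    by rewrite -K1 -K2; ring.
  by field.
- rewrite -[LHS]mul1r -cs.
  transitivity (cos (t * s) * q0 0 j - sin (t * s) * (t * p0 0 j)).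
    by rewrite -K1 -K2; ring.
  by ring.
Qed.

Lemma hamiltonian_curve_rotate z : TS2 z -> 0 < normq z ->
  hamiltonian_curve (fun s => rotate (normq z * s) z).
Proof.
move=> TSz t0 s; set t := normq z in t0 *.
have [TSg tg] := rotate_TS2 (t * s) TSz t0.
have t1 : t != 0 by rewrite gt_eqF.
have dt (r : R) : is_derive r (1 : R) (fun y : R => t * y) t.
  have := is_deriveZ t (is_derive_id r (1 : R)).
  by rewrite /GRing.scale /= mulr1.
have dcos : is_derive s (1 : R) (fun y => cos (t * y)) (- sin (t * s) * t).
  exact: (is_derive1_comp (is_derive_cos (t * s)) (dt s)).
have dsin : is_derive s (1 : R) (fun y => sin (t * y)) (cos (t * s) * t).
  exact: (is_derive1_comp (is_derive_sin (t * s)) (dt s)).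
have [p [q zE]] := cvecP z.
set gamma := fun s => rotate (t * s) z.
pose dp := im_part (gamma s); pose dq := - t ^+ 2 *: re_part (gamma s).
have dre j : is_derive s (1 : R) (fun s => complex.Re (gamma s 0 j)) (dp 0 j).
  rewrite (_ : (fun _ => _) =
      (p 0 j \*: (fun y => cos (t * y))) + ((q 0 j / t) \*: (fun y => sin (t * y)))).
    apply: (is_derive_eq (is_deriveD (is_deriveZ _ dcos) (is_deriveZ _ dsin))).
    rewrite /dp /gamma zE rotate_cvec -zE -/t im_cvec !mxE /GRing.scale /=.
    by field.
  apply: funext => y; rewrite /gamma zE rotate_cvec -zE -/t !mxE /=.
  by transitivity (p 0 j * cos (t * y) + q 0 j / t * sin (t * y)); [field|].
have dim j : is_derive s (1 : R) (fun s => complex.Im (gamma s 0 j)) (dq 0 j).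
  rewrite (_ : (fun _ => _) =
      (q 0 j \*: (fun y => cos (t * y))) + ((- t * p 0 j) \*: (fun y => sin (t * y)))).
    apply: (is_derive_eq (is_deriveD (is_deriveZ _ dcos) (is_deriveZ _ dsin))).
    rewrite /dq /gamma zE rotate_cvec -zE -/t re_cvec !mxE /GRing.scale /=.
    by field.
  apply: funext => y; rewrite /gamma zE rotate_cvec -zE -/t !mxE /=.
  by transitivity (q 0 j * cos (t * y) + (- t * p 0 j) * sin (t * y)); [ring|].
split; first exact: TSg.
  by move=> j; split; [have [] := dre j|have [] := dim j].
move=> v [pv _].
have -> : velocity gamma s 1 = cvec dp dq.
  apply/rowP => j; rewrite !mxE; congr Complex.
    by have [_] := dre j; rewrite !mxE.
  by have [_] := dim j; rewrite !mxE.
have [a [b vE]] := cvecP v.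
by rewrite vE omega_std_cvec im_cvec dotrZl -[a](re_cvec a b) -vE pv mulr0 subr0.
Qed.

Lemma cogeodesicE s z w : TS2 z -> 0 < normq z ->
  cogeodesic s z w <-> w = rotate (normq z * s) z.
Proof.
move=> TSz t0; split=> [[gamma [H g0 <-]]|->].
  by rewrite (hamiltonian_curveE s H) g0.
exists (fun s => rotate (normq z * s) z); split=> //.
  exact: hamiltonian_curve_rotate.
rewrite mulr0 /rotate sin0 cos0 mul0r mulr0 !scale1r !scale0r addr0 subr0.
exact: cvecK.
Qed.

End Flow.

(** * The map from the cut to the projective plane *)

Section CutToProjectivePlane.
Context {R : realType}.
Local Notation C3 := 'rV[R[i]]_3.
Implicit Types (p q : 'rV[R]_3) (z : C3) (c : set C3) (t s th : R).

Lemma angle_exists (a b : R) : a ^+ 2 + b ^+ 2 = 1 ->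
  exists th, cos th = a /\ sin th = b.
Proof.
move=> ab; have a1 : -1 <= a <= 1.
  by rewrite -ler_norml -(@ler_sqr _ `|a| 1) ?nnegrE// real_normK ?num_real//;
     nra.
have ca : cos (acos a) = a by rewrite acosK// in_itv.
have sa : sin (acos a) = `|b|.
  by rewrite sin_acos// -sqrtr_sqr; congr Num.sqrt; rewrite -ab; ring.
have [b0|b0] := leP 0 b; first by exists (acos a); rewrite sa ger0_norm.
by exists (- acos a); rewrite cosN sinN sa ltr0_norm// opprK.
Qed.

Lemma normq_le1 p q : (normq (cvec p q) <= 1) = (dotr q q <= 1).
Proof. by rewrite normq_cvec -[X in _ <= X]sqrtr1 ler_sqrt. Qed.

Lemma normq_lt1 p q : (normq (cvec p q) < 1) = (dotr q q < 1).
Proof. by rewrite normq_cvec -[X in _ < X]sqrtr1 ltr_sqrt. Qed.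

Lemma normq_eq1 p q : normq (cvec p q) = 1 <-> dotr q q = 1.
Proof.
split=> [q1|q1]; first by rewrite -(sqr_normq p) q1 expr1n.
by rewrite normq_cvec q1 sqrtr1.
Qed.

Lemma D1S2_cvec p q :
  D1S2 (cvec p q) <-> [/\ dotr p p = 1, dotr p q = 0 & dotr q q <= 1].
Proof.
rewrite /D1S2 /= TS2_cvec normq_le1.
by split=> [[[? ?] ?]|[? ? ?]]; split.
Qed.

Lemma U1S2_cvec p q :
  U1S2 (cvec p q) <-> [/\ dotr p p = 1, dotr p q = 0 & dotr q q < 1].
Proof.
rewrite /U1S2 /= TS2_cvec normq_lt1.
by split=> [[[? ?] ?]|[? ? ?]]; split.
Qed.

(** For [|q| <= 1], the larger positive solution [a] of [a^2 + |q|^2 / a^2 = 2]; the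
    smaller one tends to 0 as [q] does. *)
Definition stretch q : R := Num.sqrt (1 + Num.sqrt (1 - dotr q q)).

Lemma stretch_gt0 q : 0 < stretch q.
Proof. by rewrite sqrtr_gt0 ltr_pwDl// sqrtr_ge0. Qed.

Lemma sqr_stretch q : stretch q ^+ 2 = 1 + Num.sqrt (1 - dotr q q).
Proof. by rewrite sqr_sqrtr// addr_ge0// sqrtr_ge0. Qed.

Lemma stretchN q : stretch (- q) = stretch q.
Proof. by rewrite /stretch !dotrE opprK. Qed.

(** For any positive function [a], the map [p + i q |-> a p + i q / a] preserves
    [omega_std] on the cotangent bundle; this choice of [a] sends it to the sphere
    of square radius 2, on which [omega_std] is the pullback of twice the
    Fubini-Study form. *)
Definition sphere_point z : C3 :=
  cvec (stretch (im_part z) *: re_part z) ((stretch (im_part z))^-1 *: im_part z).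

Lemma sphere_point_cvec p q :
  sphere_point (cvec p q) = cvec (stretch q *: p) ((stretch q)^-1 *: q).
Proof. by rewrite /sphere_point re_cvec im_cvec. Qed.

Lemma sphere_point_opp z : sphere_point (- z) = - sphere_point z.
Proof.
have [p [q ->]] := cvecP z.
by rewrite opp_cvec !sphere_point_cvec opp_cvec stretchN !scalerN.
Qed.

Lemma sphere_point_parts p q (r := Num.sqrt (1 - dotr q q)) : dotr q q <= 1 ->
  stretch q ^+ 2 = 1 + r /\ (stretch q)^-1 ^+ 2 * dotr q q = 1 - r.
Proof.
move=> q1; rewrite sqr_stretch; split=> //.
rewrite exprVn sqr_stretch -/r.
have r0 : 0 <= r by exact: sqrtr_ge0.
have rr : r ^+ 2 = 1 - dotr q q by rewrite sqr_sqrtr// subr_ge0.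
have -> : dotr q q = 1 - r ^+ 2 by rewrite rr; ring.
by field; rewrite gt_eqF// ltr_pwDl.
Qed.

Lemma sqnorm_sphere_point z : D1S2 z -> sqnorm (sphere_point z) = 2.
Proof.
have [p [q ->]] := cvecP z; rewrite D1S2_cvec => -[pp pq q1].
have [e1 e2] := sphere_point_parts p q1.
rewrite sphere_point_cvec sqnorm_cvec !dotrE pp mulr1 -expr2 e1 mulrA -expr2 e2.
by ring.
Qed.

Lemma sphere_point_neq0 z : D1S2 z -> sphere_point z != 0.
Proof. by rewrite -sqnorm_gt0 => /sqnorm_sphere_point ->. Qed.

Lemma sphere_point_boundary z : normq z = 1 -> sphere_point z = z.
Proof.
have [p [q ->]] := cvecP z; rewrite normq_eq1 sphere_point_cvec /stretch => ->.
by rewrite subrr sqrtr0 addr0 sqrtr1 invr1 !scale1r.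
Qed.

Lemma rotate_boundary th z : normq z = 1 ->
  rotate th z = (cos th +i* - sin th)%C *: z.
Proof.
have [p [q ->]] := cvecP z; rewrite rotate_cvec => ->.
by rewrite scale_cvec divr1 mul1r !scaleNr opprK.
Qed.

Lemma hcoordN z : hcoord (- z) = hcoord z.
Proof. by rewrite -scaleN1r hcoord_scale// oppr_eq0 oner_eq0. Qed.

Lemma phase_neq0 th : (cos th +i* - sin th)%C != 0 :> R[i].
Proof.
rewrite eq_complex /= oppr_eq0 -sqrf_eq0 -[sin th == 0]sqrf_eq0.
rewrite -paddr_eq0 ?sqr_ge0// cos2Dsin2; exact: oner_neq0.
Qed.

Lemma phaseD th th' : ((cos th +i* - sin th) * (cos th' +i* - sin th'))%C =
  (cos (th + th') +i* - sin (th + th'))%C :> R[i].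
Proof.
by rewrite cosD sinD; apply/eqP; rewrite eq_complex /=; apply/andP; split;
   apply/eqP; ring.
Qed.

(** The class of [- z] is reached at time [pi], so a boundary class is one circle. *)
Lemma cut_class_boundary z : TS2 z -> normq z = 1 ->
  cut_class z = [set w | exists th, w = (cos th +i* - sin th)%C *: z].
Proof.
move=> TSz z1; have t0 : 0 < normq z by rewrite z1.
have flow s w : cogeodesic s z w <-> w = (cos s +i* - sin s)%C *: z.
  by rewrite cogeodesicE// z1 mul1r rotate_boundary.
have opp th : - ((cos th +i* - sin th)%C *: z) =
    (cos (th + pi) +i* - sin (th + pi))%C *: z.
  rewrite -scaleNr; congr (_ *: _).
  by rewrite cosDpi sinDpi.
have z0 : z = (cos 0 +i* - sin 0)%C *: z.
  by rewrite cos0 sin0 oppr0 scale1r.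
apply/seteqP; split=> w.
  move=> [[->|->]|[_ [s [z' [/flow ->]]]]].
  - by exists 0.
  - by exists (0 + pi); rewrite -opp -z0.
  - by move=> [->|->]; [exists s|exists (s + pi); rewrite opp].
move=> [th ->]; right; split=> //; exists th; eexists.
by split; [exact/flow|left].
Qed.

(** The union saves the choice of a representative: all points of a class of the
    cut have the same image, see [cut_to_CP_class]. *)
Definition cut_to_CP c : set C3 := \bigcup_(z in c) hcoord (sphere_point z).

Lemma cut_to_CP_const c (b : set C3) (z : C3) : c z ->
  (forall w, c w -> hcoord (sphere_point w) = b) -> cut_to_CP c = b.
Proof.
move=> cz cb; apply/seteqP; split=> [x [w cw]|x bx]; first by rewrite cb.
by exists z => //; rewrite cb.
Qed.

(** [sphere_point] commutes with [z |-> - z]; on the boundary it is the identity, and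
    there the flow multiplies [z] by phases. *)
Lemma cut_to_CP_class z : D1S2 z ->
  cut_to_CP (cut_class z) = hcoord (sphere_point z).
Proof.
move=> [TSz]; rewrite le_eqVlt => /orP[/eqP z1|z1].
  rewrite cut_class_boundary//; apply: (@cut_to_CP_const _ _ z).
    by exists 0; rewrite cos0 sin0 oppr0 scale1r.
  move=> _ [th ->]; rewrite -rotate_boundary// sphere_point_boundary; last first.
    by have [_ ->] := rotate_TS2 th TSz (eq_ind_r (fun x => 0 < x) ltr01 z1).
  by rewrite rotate_boundary// sphere_point_boundary// hcoord_scale// phase_neq0.
rewrite cut_class_interior//; apply: (@cut_to_CP_const _ _ z); first by left.
by move=> w [->|->]//; rewrite sphere_point_opp hcoordN.
Qed.

Lemma cut_class_phase th z : TS2 z -> normq z = 1 ->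
  cut_class ((cos th +i* - sin th)%C *: z) = cut_class z.
Proof.
move=> TSz z1; have t0 : 0 < normq z by rewrite z1.
have [] := rotate_TS2 th TSz t0; rewrite rotate_boundary// z1 => TSw w1.
rewrite !cut_class_boundary//; apply/seteqP; split=> w [s ->].
  by exists (s + th); rewrite scalerA phaseD.
by exists (s - th); rewrite scalerA phaseD subrK.
Qed.

(** The bilinear square of [sphere_point (p + i q)] is [2 r] for
    [r = sqrt (1 - |q|^2)].  A factor of modulus 1 between two such points is thus
    [1] or [-1], unless [r = 0]; both points are then on the boundary, where such a
    factor is the effect of the flow. *)
Lemma cut_to_CP_inj : {in cut &, injective cut_to_CP}.
Proof.
move=> _ _ /set_mem[z Dz <-] /set_mem[z' Dz' <-].
rewrite !cut_to_CP_class// => /hcoord_eq[[a b] c0].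
move: Dz Dz'; have [p [q ->]] := cvecP z; have [p' [q' ->]] := cvecP z'.
move=> Dz Dz'; rewrite !sphere_point_cvec scale_cvec.
have [pp pq q1] := (D1S2_cvec p q).1 Dz.
have [pp' pq' q1'] := (D1S2_cvec p' q').1 Dz'.
have [e1 e2] := sphere_point_parts p q1.
have [e1' e2'] := sphere_point_parts p' q1'.
have A0 := stretch_gt0 q; have A0' := stretch_gt0 q'.
set r := Num.sqrt (1 - dotr q q) in e1 e2 *.
set r' := Num.sqrt (1 - dotr q' q') in e1' e2' *.
have r0 : 0 <= r by exact: sqrtr_ge0.
have r0' : 0 <= r' by exact: sqrtr_ge0.
set A := stretch q in A0 e1 e2 *; set A' := stretch q' in A0' e1' e2' *.
move=> /cvec_inj[eqp eqq].
have := congr1 (fun x => dotr x x) eqp; rewrite !dotrE (dotrC q p) pp pp' pq.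
have := congr1 (fun x => dotr x x) eqq; rewrite !dotrE (dotrC q p) pp pq.
have := congr2 (@dotr R 3) eqp eqq; rewrite !dotrE (dotrC q p) pp pq pq'.
have AA : A * A^-1 = 1 by rewrite mulfV// gt_eqF.
rewrite !(mulr0, mulr1, oppr0, addr0, add0r, subr0) => h1 h2 h3.
have {}h1 : a * b * r = 0.
  have : a * b * (A ^+ 2 - A^-1 ^+ 2 * dotr q q) = 0 by rewrite [RHS]h1; ring.
  by rewrite e1 e2; lra.
have {}h3 : 1 + r' = a ^+ 2 * (1 + r) + b ^+ 2 * (1 - r).
  by rewrite -e1' -e1 -e2 expr2 [LHS]h3; ring.
have {}h2 : 1 - r' = a ^+ 2 * (1 - r) + b ^+ 2 * (1 + r).
  by rewrite -e2' -e1 -e2 [in LHS]expr2 -mulrA [LHS]h2; ring.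
have ab1 : a ^+ 2 + b ^+ 2 = 1 by lra.
have [rE|rN] := eqVneq r 0.
  have rE' : r' = 0 by rewrite rE in h2 h3; lra.
  have qq (u : 'rV[R]_3) : dotr u u <= 1 -> Num.sqrt (1 - dotr u u) = 0 -> dotr u u = 1.
    by move=> u1 /eqP; rewrite sqrtr_eq0 => ?; apply/eqP; rewrite eq_le u1; lra.
  have [th [ca sb]] : exists th, cos th = a /\ sin th = - b.
    by apply: angle_exists; rewrite sqrrN.
  have A1 : A = 1 by rewrite /A /stretch -/r rE addr0 sqrtr1.
  have A1' : A' = 1 by rewrite /A' /stretch -/r' rE' addr0 sqrtr1.
  move: eqp eqq; rewrite A1 A1' invr1 !scale1r => -> ->.
  rewrite -scale_cvec -[b]opprK -sb -ca cut_class_phase//; first by case: Dz.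
  by apply/normq_eq1; exact: qq.
have {}h1 : a * b = 0 by move/eqP: h1; rewrite mulf_eq0 (negPf rN) orbF => /eqP.
have rgt0 : 0 < r by rewrite lt_neqAle eq_sym rN.
have b0 : b = 0.
  move/eqP: h1; rewrite mulf_eq0 => /orP[/eqP a0|/eqP//].
  by rewrite a0 expr0n /= in h2 h3 ab1; nra.
rewrite b0 expr0n /= addr0 in ab1 h3.
have rr' : r' = r by rewrite ab1 in h3; lra.
have AA' : A' = A by rewrite /A' /A /stretch -/r -/r' rr'.
move: eqp eqq; rewrite b0 !scale0r subr0 addr0 AA' !scalerA.
rewrite ![a * _]mulrC -!scalerA => /scalerI-/(_ (lt0r_neq0 A0)) ->.
move=> /scalerI; rewrite invr_eq0 => /(_ (lt0r_neq0 A0)) ->.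
have U : U1S2 (cvec p q).
  apply/U1S2_cvec; split=> //; rewrite lt_neqAle q1 andbT; apply: contraNneq rN.
  by rewrite /r => ->; rewrite subrr sqrtr0.
move/eqP: ab1; rewrite sqrf_eq1 => /orP[]/eqP ->; first by rewrite !scale1r.
rewrite !scaleN1r -opp_cvec !cut_class_interior//; last first.
  have [? ? ?] := (U1S2_cvec p q).1 U.
  by rewrite opp_cvec; apply/U1S2_cvec; rewrite !dotrE !opprK.
by rewrite /antip opprK; apply/seteqP; split=> x [->|->]; by [left|right].
Qed.

(** With [t = |q|], [e = q / t] and [S = sqrt (1 + t)], this is
    [S (p + i e) + w (p - i e)].  As the flow multiplies [p + i e] and [p - i e] by
    inverse phases, the circle action on the pairs [(z, w)] only changes the phase
    of the point. *)
Definition reduction_point z (w : R[i]) : C3 :=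
  let p := re_part z in let q := im_part z in let t := normq z in
  let S := Num.sqrt (1 + t) in
  cvec ((S + complex.Re w) *: p + (complex.Im w / t) *: q)
      (complex.Im w *: p + ((S - complex.Re w) / t) *: q).

Lemma sqnorm_reduction_point z (w : R[i]) : TS2 z -> 0 < normq z ->
  normq z + (complex.Re w ^+ 2 + complex.Im w ^+ 2) = 1 ->
  sqnorm (reduction_point z w) = 4.
Proof.
have [p [q ->]] := cvecP z; case: w => a b /=.
rewrite TS2_cvec /reduction_point re_cvec im_cvec => -[pp pq] t0.
have qq := sqr_normq p q; set t := normq _ in t0 qq * => tw.
have SS : Num.sqrt (1 + t) ^+ 2 = 1 + t by rewrite sqr_sqrtr// addr_ge0// ltW.
set S := Num.sqrt _ in SS *.
rewrite sqnorm_cvec !dotrE (dotrC q p) pp pq -qq /=.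
transitivity (2 * (S ^+ 2 + (a ^+ 2 + b ^+ 2))).
  by field; rewrite gt_eqF.
by rewrite SS; lra.
Qed.

(** With [t = |q|], the numbers [S = sqrt (1 + t)] and [|w| = sqrt (1 - t)] satisfy
    [(S + |w|)^2 = 2 A^2] for the factor [A] of [sphere_point], so that
    [reduction_point] is proportional to [sphere_point] if [w >= 0].  In general,
    the action of [s] on [(z, w)] multiplies [reduction_point] by
    [exp (- i s / 2)]. *)
Lemma cut_reduce_to_CP z (w : R[i]) c : TS2 z -> 0 < normq z ->
  normq z + (complex.Re w ^+ 2 + complex.Im w ^+ 2) = 1 ->
  cut_reduce z w c ->
  cut c /\ cut_to_CP c = hcoord (reduction_point z w).
Proof.
move=> TSz t0 tw [s [z' [sw zz' ->]]].
have [TSr tr] := rotate_TS2 (s / 2) TSz t0.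
move: zz'; rewrite cogeodesicE// (_ : normq z * _ = s / 2); last first.
  by field; rewrite gt_eqF.
move=> z'E.
have Dz' : D1S2 z'.
  by rewrite z'E; split=> //; rewrite tr -tw lerDl addr_ge0// sqr_ge0.
split; first by exists z'.
rewrite cut_to_CP_class//.
move: TSz t0 tw sw tr z'E Dz'; have [p [q ->]] := cvecP z; case: w => a b.
set t := normq (cvec p q) => TSz t0 /= tw sw tr z'E Dz'.
move: sw; rewrite lecE /= => /andP[/eqP im0].
set rho := cos s * a - - sin s * b => rho0.
have cs := cos2Dsin2 s.
have aE : a = rho * cos s.
  rewrite -[LHS]mul1r -cs /rho; transitivity ((cos s * a - - sin s * b) * cos s
    - sin s * (cos s * b + - sin s * a)); [ring|rewrite im0; ring].
have bE : b = rho * sin s.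
  rewrite -[LHS]mul1r -cs /rho; transitivity ((cos s * a - - sin s * b) * sin s
    + cos s * (cos s * b + - sin s * a)); [ring|rewrite im0; ring].
have rr : rho ^+ 2 = 1 - t.
  rewrite -tw [in RHS]aE [in RHS]bE.
  by transitivity (rho ^+ 2 * (cos s ^+ 2 + sin s ^+ 2)); [rewrite cs mulr1|ring].
have t1 : t != 0 by rewrite gt_eqF.
set S := Num.sqrt (1 + t).
have SS : S ^+ 2 = 1 + t by rewrite sqr_sqrtr// addr_ge0// ltW.
have S0 : 0 < S by rewrite sqrtr_gt0 addr_gt0.
have Sr0 : 0 < S + rho by rewrite ltr_wpDr.
set p' := re_part z'; set q' := im_part z'.
have qq' : dotr q' q' = t ^+ 2 by rewrite -tr -z'E -(cvecK z') sqr_normq.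
have rE : Num.sqrt (1 - dotr q' q') = S * rho.
  rewrite qq' -[RHS]ger0_norm ?mulr_ge0// ?ltW// -sqrtr_sqr exprMn SS rr.
  by congr Num.sqrt; ring.
have A0 := stretch_gt0 q'; have := sqr_stretch q'; rewrite rE.
rewrite /sphere_point -/p' -/q'; set A := stretch q' in A0 * => AA.
have A1 : A != 0 by rewrite gt_eqF.
have Sr1 : S + rho != 0 by rewrite gt_eqF.
have [k kE] : exists k : R, k = 2 * A / (S + rho) by eexists.
have kA : k * A = S + rho.
  rewrite kE; transitivity (2 * A ^+ 2 / (S + rho)); first by field.
  by apply: (mulIf Sr1); rewrite divfK// AA; ring: SS rr.
have kA' : k / A = (S - rho) / t.
  transitivity (2 / (S + rho)); first by rewrite kE; field; rewrite A1 Sr1.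
  apply: (mulIf t1); rewrite divfK//; apply: (mulIf Sr1).
  by rewrite mulrAC divfK//; ring: SS rr.
have k0 : k != 0.
  by rewrite kE mulf_eq0 mulf_eq0 invr_eq0 pnatr_eq0 (negPf A1) (negPf Sr1).
pose C := cos (s / 2); pose D := sin (s / 2).
(* The flow turns by half of the angle by which [w] is turned. *)
have sE : s = s / 2 + s / 2 by field.
have csE : cos s = C ^+ 2 - D ^+ 2 by rewrite [in LHS]sE cosD !expr2.
have snE : sin s = C * D + C * D by rewrite [in LHS]sE sinD -/C -/D; ring.
have CD : C ^+ 2 + D ^+ 2 = 1 by exact: cos2Dsin2.
have z'cvec : z' = cvec (C *: p + (D / t) *: q) (C *: q - (t * D) *: p).
  by rewrite z'E rotate_cvec.
have p'E : p' = C *: p + (D / t) *: q by rewrite /p' z'cvec re_cvec.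
have q'E : q' = C *: q - (t * D) *: p by rewrite /q' z'cvec im_cvec.
rewrite /reduction_point re_cvec im_cvec -/t -/S /=.
rewrite -[LHS](@hcoord_scale _ _ (k * C +i* (k * D))%C); last first.
  rewrite eq_complex /= !mulf_eq0 (negPf k0) /= -sqrf_eq0 -[D == 0]sqrf_eq0.
  by rewrite -paddr_eq0 ?sqr_ge0// CD oner_neq0.
rewrite scale_cvec !scalerA.
have -> : k * C * A = C * (S + rho) by rewrite -kA; ring.
have -> : k * D * A = D * (S + rho) by rewrite -kA; ring.
have -> : k * C / A = C * ((S - rho) / t) by rewrite -kA'; ring.
have -> : k * D / A = D * ((S - rho) / t) by rewrite -kA'; ring.
rewrite p'E q'E aE bE csE snE.
congr (hcoord (cvec _ _)); apply/rowP => j; rewrite !mxE.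
  by rewrite -[S in RHS]mulr1 -CD; field.
by rewrite -[S in RHS]mulr1 -CD; field.
Qed.

Lemma cut_reduce_exists z (w : R[i]) : TS2 z -> 0 < normq z ->
  exists c, cut_reduce z w c.
Proof.
move=> TSz t0; case: w => a b.
suff [s [sre sim]] : exists s : R, 0 <= cos s * a + sin s * b /\
    cos s * b - sin s * a = 0.
  exists (cut_class (rotate (normq z * (s / (2 * normq z))) z)), s; eexists.
  split; last by []; last exact/cogeodesicE.
  rewrite lecE /=; apply/andP; split; first by rewrite mulNr sim.
  by rewrite mulNr opprK.
have [ab0|abN0] := eqVneq (a ^+ 2 + b ^+ 2) 0.
  move/eqP: ab0; rewrite paddr_eq0 ?sqr_ge0// !sqrf_eq0 => /andP[/eqP-> /eqP->].
  by exists 0; rewrite !mulr0 addr0 subr0.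
have ab0 : 0 < a ^+ 2 + b ^+ 2 by rewrite lt_neqAle eq_sym abN0 addr_ge0// sqr_ge0.
pose n := Num.sqrt (a ^+ 2 + b ^+ 2).
have n0 : 0 < n by rewrite sqrtr_gt0.
have nn : n ^+ 2 = a ^+ 2 + b ^+ 2 by rewrite sqr_sqrtr// ltW.
have [s [sc ss]] : exists s, cos s = a / n /\ sin s = b / n.
  apply: angle_exists; rewrite !expr_div_n -mulrDl -nn divff//.
  by rewrite expf_neq0// gt_eqF.
exists s; rewrite sc ss; split; last by ring.
rewrite (_ : _ + _ = (a ^+ 2 + b ^+ 2) / n); last by ring.
by rewrite divr_ge0// ltW.
Qed.

End CutToProjectivePlane.

(** * Smoothness of the map and of its inverse *)

Section SmoothVectors.
Context {R : realType} {n m : nat}.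
Implicit Types (P Q : 'rV[R]_n -> 'rV[R]_m) (f g : 'rV[R]_n -> R) (x : 'rV[R]_n).

Lemma smooth_near_gt f x (a : R) : smooth_near f x -> a < f x ->
  \forall y \near x, a < f y.
Proof.
move=> /smooth_near_continuous cf afx.
by apply: (cf [set b | a < b]); apply: open_nbhs_nbhs; split; [exact: open_gt|].
Qed.

Lemma smooth_near_lt f x (a : R) : smooth_near f x -> f x < a ->
  \forall y \near x, f y < a.
Proof.
move=> /smooth_near_continuous cf afx.
by apply: (cf [set b | b < a]); apply: open_nbhs_nbhs; split; [exact: open_lt|].
Qed.

Lemma smooth_near_coord x (j : 'I_n) : smooth_near (fun y : 'rV[R]_n => y 0 j) x.
Proof.
have @f : {linear 'rV[R]_n -> R}.
  by exists (fun N : 'rV[R]_n => N 0 j); do 2![eexists]; do ?[constructor];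
     rewrite ?mxE// => ? *; rewrite ?mxE//; move=> ?; rewrite !mxE.
rewrite (_ : (fun _ => _) = f)//.
by apply: smooth_near_linear_form; exact: coord_continuous.
Qed.

Lemma rsmooth_near_add P Q x : rsmooth_near P x -> rsmooth_near Q x ->
  rsmooth_near (fun y => P y + Q y) x.
Proof.
move=> sP sQ j; apply: smooth_near_ext (smooth_near_add (sP j) (sQ j)).
by near=> y; rewrite mxE.
Unshelve. all: by end_near. Qed.

Lemma rsmooth_near_scale f P x : smooth_near f x -> rsmooth_near P x ->
  rsmooth_near (fun y => f y *: P y) x.
Proof.
move=> sf sP j; apply: smooth_near_ext (smooth_near_mul sf (sP j)).
by near=> y; rewrite mxE.
Unshelve. all: by end_near. Qed.

Lemma rsmooth_near_sub P Q x : rsmooth_near P x -> rsmooth_near Q x ->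
  rsmooth_near (fun y => P y - Q y) x.
Proof.
move=> sP sQ j; apply: smooth_near_ext (smooth_near_sub (sP j) (sQ j)).
by near=> y; rewrite !mxE.
Unshelve. all: by end_near. Qed.

Lemma smooth_near_dotr P Q x : rsmooth_near P x -> rsmooth_near Q x ->
  smooth_near (fun y => dotr (P y) (Q y)) x.
Proof.
by move=> sP sQ; apply: smooth_near_sum => j; exact: smooth_near_mul.
Qed.

Lemma vsmooth_near_re (L : 'rV[R]_n -> 'rV[R[i]]_m) x :
  vsmooth_near L x -> rsmooth_near (fun y => re_part (L y)) x.
Proof.
move=> sL j; apply: smooth_near_ext (sL j).1.
by near=> y; rewrite mxE.
Unshelve. all: by end_near. Qed.

Lemma vsmooth_near_im (L : 'rV[R]_n -> 'rV[R[i]]_m) x :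
  vsmooth_near L x -> rsmooth_near (fun y => im_part (L y)) x.
Proof.
move=> sL j; apply: smooth_near_ext (sL j).2.
by near=> y; rewrite mxE.
Unshelve. all: by end_near. Qed.

Lemma vsmooth_near_cvec P Q x : rsmooth_near P x -> rsmooth_near Q x ->
  vsmooth_near (fun y => cvec (P y) (Q y)) x.
Proof.
move=> sP sQ j; split.
  by apply: smooth_near_ext (sP j); near=> y; rewrite !mxE.
by apply: smooth_near_ext (sQ j); near=> y; rewrite !mxE.
Unshelve. all: by end_near. Qed.

Lemma vsmooth_near_near (L : 'rV[R]_n -> 'rV[R[i]]_m) x :
  vsmooth_near L x -> \forall y \near x, vsmooth_near L y.
Proof.
move=> sL.
have H j : \forall y \near x, csmooth_near (fun z => L z 0 j) y.
  have [sr si] := sL j.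
  exact: filterI (smooth_near_near sr) (smooth_near_near si).
exact: (filter_forall (f := fun j y => csmooth_near (fun z => L z 0 j) y)
  (nbhs_filter x) H).
Qed.

End SmoothVectors.

Section SmoothMaps.
Context {R : realType}.
Local Notation C3 := 'rV[R[i]]_3.
Implicit Types (X Y p q : 'rV[R]_3) (z : C3).

Lemma smooth_near_normq n (L : 'rV[R]_n -> C3) (x : 'rV[R]_n) :
  vsmooth_near L x -> 0 < normq (L x) -> smooth_near (fun y => normq (L y)) x.
Proof.
move=> /vsmooth_near_im sL; rewrite /normq sqrtr_gt0 => L0.
exact: smooth_near_sqrt (smooth_near_dotr sL sL).
Qed.

Lemma smooth_near_stretch n (L : 'rV[R]_n -> C3) (x : 'rV[R]_n) :
  vsmooth_near L x -> U1S2 (L x) -> smooth_near (fun y => stretch (im_part (L y))) x.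
Proof.
move=> sL UL; have sim := vsmooth_near_im sL.
apply: smooth_near_sqrt; first by rewrite ltr_pwDl// sqrtr_ge0.
apply: smooth_near_add; first exact: smooth_near_cst.
apply: smooth_near_sqrt; last first.
  by apply: smooth_near_sub (smooth_near_dotr _ _) => //; exact: smooth_near_cst.
rewrite subr_gt0; move: UL; rewrite -{1}(cvecK (L x)).
by move=> /U1S2_cvec[].
Qed.

Lemma vsmooth_near_sphere_point n (L : 'rV[R]_n -> C3) (x : 'rV[R]_n) :
  vsmooth_near L x -> U1S2 (L x) -> vsmooth_near (fun y => sphere_point (L y)) x.
Proof.
move=> sL UL; have sA := smooth_near_stretch sL UL.
apply: vsmooth_near_cvec; apply: rsmooth_near_scale => //.
- exact: vsmooth_near_re.
- by apply: smooth_near_inv => //; rewrite gt_eqF// stretch_gt0.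
- exact: vsmooth_near_im.
Qed.

Lemma vsmooth_near_reduction_point n (L : 'rV[R]_n -> C3)
    (w : 'rV[R]_n -> R[i]) (x : 'rV[R]_n) :
  vsmooth_near L x -> csmooth_near w x -> 0 < normq (L x) ->
  vsmooth_near (fun y => reduction_point (L y) (w y)) x.
Proof.
move=> sL [sa sb] t0; have sre := vsmooth_near_re sL; have sim := vsmooth_near_im sL.
have st := smooth_near_normq sL t0.
have t1 : normq (L x) != 0 by rewrite gt_eqF.
have sS : smooth_near (fun y => Num.sqrt (1 + normq (L y))) x.
  apply: smooth_near_sqrt; first by rewrite ltr_pwDl// ltW.
  by apply: smooth_near_add => //; exact: smooth_near_cst.
apply: vsmooth_near_cvec; apply: rsmooth_near_add; apply: rsmooth_near_scale => //.
- exact: smooth_near_add.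
- exact: smooth_near_div.
- by apply: smooth_near_div => //; exact: smooth_near_sub.
Qed.

Lemma cut_plots_cut n (P : 'rV[R]_n -> set C3) (x : 'rV[R]_n) :
  cut_plots P x -> \forall y \near x, cut (P y).
Proof.
move=> [[L [_ H]]|[L [w [_ _ H]]]]; near=> y.
  have [|[TS t1] ->] := near H y; first by [].
  by exists (L y) => //; split=> //; exact: ltW.
have [|TS t0 tw cr] := near H y; first by [].
by have [] := cut_reduce_to_CP TS t0 tw cr.
Unshelve. all: by end_near. Qed.

Lemma cut_plots_near n (P : 'rV[R]_n -> set C3) (x : 'rV[R]_n) :
  cut_plots P x -> \forall y \near x, cut_plots P y.
Proof.
move=> [[L [sL H]]|[L [w [sL sw H]]]].
  apply: filterS2 (vsmooth_near_near sL) (near_join H) => y sLy Hy.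
  by left; exists L.
have [swr swi] := sw.
apply: filterS3 (vsmooth_near_near sL)
  (filterI (smooth_near_near swr) (smooth_near_near swi)) (near_join H).
by move=> y sLy swy Hy; right; exists L, w.
Qed.

Lemma cut_to_CP_smooth : smooth_map (@cut_plots R) (CP_plots 2) (@cut_to_CP R).
Proof.
move=> n P x [[L [sL H]]|[L [w [sL sw H]]]].
  have [UL _] := nbhs_singleton H.
  exists (fun y => sphere_point (L y)); split.
    exact: vsmooth_near_sphere_point.
  near=> y; have [|[TS t1] Py] := near H y; first by [].
  have D : D1S2 (L y) by split=> //; exact: ltW.
  by rewrite sphere_point_neq0//= Py cut_to_CP_class.
have [_ t0 _ _] := nbhs_singleton H.
exists (fun y => reduction_point (L y) (w y)); split.
  exact: vsmooth_near_reduction_point.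
near=> y; have [|TS ty tw cr] := near H y; first by [].
split; last by have [] := cut_reduce_to_CP TS ty tw cr.
by rewrite -sqnorm_gt0 sqnorm_reduction_point// ltr0n.
Unshelve. all: by end_near. Qed.

Definition quadric z : R[i] := \sum_j z 0 j ^+ 2.

Lemma quadric_cvec p q : quadric (cvec p q) = ((dotr p p - dotr q q) +i* (2 * dotr p q))%C.
Proof.
rewrite /quadric /dotr !big_ord_recr !big_ord0 /= !mxE.
by apply/eqP; rewrite eq_complex /=; apply/andP; split; apply/eqP => /=; ring.
Qed.

Lemma quadric_scale (a : R[i]) z : quadric (a *: z) = a ^+ 2 * quadric z.
Proof. by rewrite mulr_sumr; apply: eq_bigr => j _; rewrite mxE exprMn. Qed.

Lemma quadric_normalize z : quadric z != 0 ->
  exists a b : R, (a +i* b)%C != 0 /\ quadric ((a +i* b)%C *: z) = 1.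
Proof.
move=> zz; exists (complex.Re (sqrtc (quadric z)^-1)), (complex.Im (sqrtc (quadric z)^-1)).
have -> : (complex.Re (sqrtc (quadric z)^-1) +i* complex.Im (sqrtc (quadric z)^-1))%C =
  sqrtc (quadric z)^-1 by case: sqrtc.
by rewrite sqrtc_eq0 invr_eq0 quadric_scale sqr_sqrtc mulVf.
Qed.

(** For [x] orthogonal to [y] and [|x| > |y|], the solution [p + i q] of the
    equation [sphere_point (p + i q) = x + i y] up to a positive factor. *)
Definition interior_point X Y : C3 :=
  cvec ((Num.sqrt (dotr X X))^-1 *: X)
      ((2 * Num.sqrt (dotr X X) / (dotr X X + dotr Y Y)) *: Y).

Lemma interior_pointP X Y : dotr X Y = 0 -> dotr Y Y < dotr X X ->
  U1S2 (interior_point X Y) /\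
  hcoord (sphere_point (interior_point X Y)) = hcoord (cvec X Y).
Proof.
move=> XY YX; rewrite /interior_point.
have Y0 := dotr_ge0 Y; have X0 : 0 < dotr X X by exact: le_lt_trans YX.
set N := Num.sqrt (dotr X X).
have N0 : 0 < N by rewrite sqrtr_gt0.
have NN : dotr X X = N ^+ 2 by rewrite sqr_sqrtr// ltW.
rewrite NN in X0 YX *; set b := dotr Y Y in Y0 YX *.
have sg0 : 0 < N ^+ 2 + b by rewrite ltr_wpDr.
have N1 : N != 0 by rewrite gt_eqF.
have sg1 : N ^+ 2 + b != 0 by rewrite gt_eqF.
set q := (_ / _) *: Y.
have qq : 1 - dotr q q = ((N ^+ 2 - b) / (N ^+ 2 + b)) ^+ 2.
  by rewrite /q !dotrE -/b; field.
have r0 : 0 < (N ^+ 2 - b) / (N ^+ 2 + b) by rewrite divr_gt0// subr_gt0.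
split.
  apply/U1S2_cvec; rewrite -subr_gt0 qq exprn_gt0// !dotrE XY NN; split=> //.
    by field.
  by rewrite !mulr0.
have A0 := stretch_gt0 q; have := sqr_stretch q.
rewrite sphere_point_cvec; set A := stretch q in A0 *.
rewrite qq sqrtr_sqr gtr0_norm// => AA.
have A1 : A != 0 by rewrite gt_eqF.
rewrite -[RHS](@hcoord_cvec_scale _ _ (A / N)); last by rewrite mulf_neq0// invr_eq0.
congr (hcoord (cvec _ _)); rewrite scalerA//; congr (_ *: _).
apply: (mulfI A1); rewrite mulVKf// mulrA -expr2 AA.
by field; rewrite N1 sg1.
Qed.

(** Let [c] be the bilinear square of [Z = X + i Y].  As
    [(|c| + conj(c))^2 c = 2 |c|^2 (|c| + Re c)], which is positive if [Re c > 0],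
    the factor [|c| + conj(c)] is a smooth substitute for a square root of
    [conj(c)]: it makes the bilinear square of [Z] positive, that is, the real part
    of [Z] orthogonal to the imaginary part and longer. *)
Lemma lift_interior_pos n (X Y : 'rV[R]_n -> 'rV[R]_3) (x : 'rV[R]_n) :
  rsmooth_near X x -> rsmooth_near Y x ->
  dotr (Y x) (Y x) < dotr (X x) (X x) ->
  exists L : 'rV[R]_n -> C3, vsmooth_near L x /\
    \forall y \near x, U1S2 (L y) /\
      hcoord (sphere_point (L y)) = hcoord (cvec (X y) (Y y)).
Proof.
move=> sX sY YX.
pose c1 y := dotr (X y) (X y) - dotr (Y y) (Y y).
pose c2 y := 2 * dotr (X y) (Y y).
have s1 : smooth_near c1 x by apply: smooth_near_sub; exact: smooth_near_dotr.
have s2 : smooth_near c2 x.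
  by apply: smooth_near_mul; [exact: smooth_near_cst|exact: smooth_near_dotr].
have c1x : 0 < c1 x by rewrite subr_gt0.
pose m y := Num.sqrt (c1 y ^+ 2 + c2 y ^+ 2).
have sm : smooth_near m x.
  apply: smooth_near_sqrt; first by rewrite ltr_pwDl ?sqr_ge0// exprn_gt0.
  by apply: smooth_near_add; exact: smooth_near_sqr.
pose X' y := (m y + c1 y) *: X y + c2 y *: Y y.
pose Y' y := (m y + c1 y) *: Y y - c2 y *: X y.
have smc := smooth_near_add sm s1.
have sX' : rsmooth_near X' x by apply: rsmooth_near_add; exact: rsmooth_near_scale.
have sY' : rsmooth_near Y' x by apply: rsmooth_near_sub; exact: rsmooth_near_scale.
have mm y : m y ^+ 2 = c1 y ^+ 2 + c2 y ^+ 2.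
  by rewrite sqr_sqrtr// addr_ge0// sqr_ge0.
have X'Y' y : dotr (X' y) (Y' y) = 0.
  have XY : dotr (X y) (Y y) = c2 y / 2 by rewrite /c2; field.
  have YY : dotr (Y y) (Y y) = dotr (X y) (X y) - c1 y by rewrite /c1; ring.
  rewrite /X' /Y' !dotrE (dotrC (Y y) (X y)) XY YY.
  transitivity (c2 y / 2 * (m y ^+ 2 - c1 y ^+ 2 - c2 y ^+ 2)); first by field.
  by rewrite mm; ring.
have Y'X' y : 0 < c1 y -> dotr (Y' y) (Y' y) < dotr (X' y) (X' y).
  move=> c1y; rewrite -subr_gt0.
  have XY : dotr (X y) (Y y) = c2 y / 2 by rewrite /c2; field.
  have YY : dotr (Y y) (Y y) = dotr (X y) (X y) - c1 y by rewrite /c1; ring.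
  rewrite /X' /Y' !dotrE (dotrC (Y y) (X y)) XY YY.
  rewrite (_ : _ - _ = (m y ^+ 2 + 2 * m y * c1 y + c1 y ^+ 2 - c2 y ^+ 2) * c1 y
    + 2 * (m y + c1 y) * c2 y ^+ 2); last by field.
  rewrite mm; have m0 : 0 <= m y by exact: sqrtr_ge0.
  apply: ltr_pwDl; last by rewrite mulr_ge0 ?sqr_ge0// mulr_ge0// addr_ge0// ltW.
  rewrite mulr_gt0// (_ : _ - _ = 2 * c1 y * (c1 y + m y)); last by ring.
  by rewrite !mulr_gt0// ltr_pwDl.
have X'0 : 0 < dotr (X' x) (X' x) by exact: le_lt_trans (dotr_ge0 _) (Y'X' x c1x).
have sN : smooth_near (fun y => Num.sqrt (dotr (X' y) (X' y))) x.
  by apply: smooth_near_sqrt => //; exact: smooth_near_dotr.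
exists (fun y => interior_point (X' y) (Y' y)); split.
  apply: vsmooth_near_cvec; apply: rsmooth_near_scale => //.
    by apply: smooth_near_inv => //; rewrite gt_eqF// sqrtr_gt0.
  apply: smooth_near_div.
  - by rewrite gt_eqF// ltr_wpDr// dotr_ge0.
  - by apply: smooth_near_mul => //; exact: smooth_near_cst.
  - by apply: smooth_near_add; exact: smooth_near_dotr.
have := smooth_near_gt s1 c1x; apply: filterS => y c1y.
have [U ->] := interior_pointP (X'Y' y) (Y'X' y c1y).
split=> //; rewrite -[RHS](@hcoord_scale _ _ ((m y + c1 y) +i* - c2 y)%C).
  by rewrite scale_cvec !scaleNr opprK.
rewrite eq_complex /= negb_and gt_eqF// ltr_wpDl// sqrtr_ge0.
by [].
Qed.

Lemma lift_interior n (Z : 'rV[R]_n -> C3) (x : 'rV[R]_n) :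
  vsmooth_near Z x -> quadric (Z x) != 0 ->
  exists L : 'rV[R]_n -> C3, vsmooth_near L x /\
    \forall y \near x, U1S2 (L y) /\
      hcoord (sphere_point (L y)) = hcoord (Z y).
Proof.
move=> sZ Zx.
have [a [b [a0 aa]]] := quadric_normalize Zx.
pose X y := a *: re_part (Z y) - b *: im_part (Z y).
pose Y y := a *: im_part (Z y) + b *: re_part (Z y).
have ZE y : (a +i* b)%C *: Z y = cvec (X y) (Y y).
  by rewrite -[in LHS](cvecK (Z y)) scale_cvec.
have sre := vsmooth_near_re sZ; have sim := vsmooth_near_im sZ.
have sX : rsmooth_near X x.
  by apply: rsmooth_near_sub; apply: rsmooth_near_scale => //; exact: smooth_near_cst.
have sY : rsmooth_near Y x.
  by apply: rsmooth_near_add; apply: rsmooth_near_scale => //; exact: smooth_near_cst.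
have YX : dotr (Y x) (Y x) < dotr (X x) (X x).
  by move: aa; rewrite ZE quadric_cvec => -[h _]; rewrite -subr_gt0 h.
have [L [sL H]] := lift_interior_pos sX sY YX.
exists L; split=> //; apply: filterS H => y [UL ->]; split=> //.
by rewrite -ZE hcoord_scale.
Qed.

(** With [u = p + i e], [e = q / |q|], one has
    [reduction_point (p + i q) w = S u + w conj(u)] and
    [u . conj(u) = 2], [u . u = 0] for the bilinear product.  Hence the bilinear
    square [c] of the point is [4 S w], which determines [w] and [t = |q|], and
    then [u = (S Z - w conj(Z)) / (2 t)] for the point [Z]. *)
Lemma reduction_point_solve X Y (c1 := dotr X X - dotr Y Y) (c2 := 2 * dotr X Y)
    (t := Num.sqrt (1 - (c1 ^+ 2 + c2 ^+ 2) / 16)) (S := Num.sqrt (1 + t))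
    (a := c1 / (4 * S)) (b := c2 / (4 * S))
    (z := cvec ((2 * t)^-1 *: ((S - a) *: X - b *: Y))
              (2^-1 *: ((S + a) *: Y - b *: X))) :
  dotr X X + dotr Y Y = 4 -> c1 ^+ 2 + c2 ^+ 2 < 16 ->
  [/\ TS2 z, normq z = t, t + (a ^+ 2 + b ^+ 2) = 1
    & reduction_point z (a +i* b)%C = cvec X Y].
Proof.
move=> XY4 c16.
have t0 : 0 < t by rewrite sqrtr_gt0 subr_gt0 ltr_pdivrMr// mul1r.
have tt : t ^+ 2 = 1 - (c1 ^+ 2 + c2 ^+ 2) / 16.
  by rewrite sqr_sqrtr// subr_ge0 ler_pdivrMr// mul1r ltW.
have S0 : 0 < S by rewrite sqrtr_gt0 addr_gt0.
have SS : t = S ^+ 2 - 1 by rewrite sqr_sqrtr ?addr_ge0 ?(ltW t0)//; ring.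
have t1 : t != 0 by rewrite gt_eqF.
have S1 : S != 0 by rewrite gt_eqF.
have c1E : c1 = 4 * S * a by rewrite /a mulrC divfK// mulf_neq0.
have c2E : c2 = 4 * S * b by rewrite /b mulrC divfK// mulf_neq0.
have ab : a ^+ 2 + b ^+ 2 = 1 - t.
  apply: (@mulfI _ (S ^+ 2)); first by rewrite expf_neq0.
  transitivity ((c1 ^+ 2 + c2 ^+ 2) / 16); first by rewrite c1E c2E; field.
  by move: tt; rewrite SS; lra.
have XX : dotr X X = 2 + 2 * S * a by move: c1E XY4; rewrite /c1; lra.
have YY : dotr Y Y = 2 - 2 * S * a by move: c1E XY4; rewrite /c1; lra.
have XY : dotr X Y = 2 * S * b by move: c2E; rewrite /c2; lra.
have bb : b ^+ 2 = 2 - S ^+ 2 - a ^+ 2 by move: ab SS; lra.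
have zz : normq z = t.
  rewrite normq_cvec -[RHS](ger0_norm (ltW t0)) -sqrtr_sqr; congr Num.sqrt.
  by rewrite !dotrE (dotrC Y X) XX YY XY SS; field: bb.
have S2t : S ^+ 2 - a ^+ 2 - b ^+ 2 = 2 * t by move: ab SS; lra.
split; [|exact: zz|by rewrite ab; ring|].
  apply/TS2_cvec; rewrite !dotrE (dotrC Y X) XX YY XY; split.
    apply: (@mulfI _ ((2 * t) ^+ 2)); first by rewrite expf_neq0// mulf_neq0.
    transitivity ((S - a) ^+ 2 * (2 + 2 * S * a) - 2 * (S - a) * b * (2 * S * b)
      + b ^+ 2 * (2 - 2 * S * a)); first by field.
    by rewrite SS; ring: bb.
  transitivity ((4 * t)^-1 * (((S - a) * (S + a) + b ^+ 2) * (2 * S * b)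
    - (S - a) * b * (2 + 2 * S * a) - (S + a) * b * (2 - 2 * S * a))); first by field.
  by ring: bb.
rewrite /reduction_point zz re_cvec im_cvec -/S /=.
congr cvec; apply/rowP => j; rewrite !mxE.
  transitivity ((S ^+ 2 - a ^+ 2 - b ^+ 2) / (2 * t) * X 0 j); first by field.
  by rewrite S2t divff ?mul1r// mulf_neq0.
transitivity ((S ^+ 2 - a ^+ 2 - b ^+ 2) / (2 * t) * Y 0 j); first by field.
by rewrite S2t divff ?mul1r// mulf_neq0.
Qed.

(** The formulas of [reduction_point_solve] are smooth wherever [t > 0], in
    particular where the bilinear square vanishes. *)
Lemma lift_boundary n (Z : 'rV[R]_n -> C3) (x : 'rV[R]_n) :
  vsmooth_near Z x -> Z x != 0 -> quadric (Z x) = 0 ->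
  exists (L : 'rV[R]_n -> C3) (w : 'rV[R]_n -> R[i]),
    [/\ vsmooth_near L x, csmooth_near w x
      & \forall y \near x,
        [/\ TS2 (L y), 0 < normq (L y),
          normq (L y) + (complex.Re (w y) ^+ 2 + complex.Im (w y) ^+ 2) = 1
          & hcoord (reduction_point (L y) (w y)) = hcoord (Z y)]].
Proof.
move=> sZ Zx Z0; have sre := vsmooth_near_re sZ; have sim := vsmooth_near_im sZ.
pose N y := dotr (re_part (Z y)) (re_part (Z y)) + dotr (im_part (Z y)) (im_part (Z y)).
have sN : smooth_near N x by apply: smooth_near_add; exact: smooth_near_dotr.
have N0 : 0 < N x by rewrite -[N x]/(sqnorm (Z x)) sqnorm_gt0.
(* The points [reduction_point z w] have square norm 4. *)
pose l y := 2 / Num.sqrt (N y).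
have sl : smooth_near l x.
  apply: smooth_near_div; [by rewrite gt_eqF// sqrtr_gt0|exact: smooth_near_cst|].
  exact: smooth_near_sqrt.
pose X y := l y *: re_part (Z y); pose Y y := l y *: im_part (Z y).
have sX : rsmooth_near X x by exact: rsmooth_near_scale.
have sY : rsmooth_near Y x by exact: rsmooth_near_scale.
pose c1 y := dotr (X y) (X y) - dotr (Y y) (Y y).
pose c2 y := 2 * dotr (X y) (Y y).
have s1 : smooth_near c1 x by apply: smooth_near_sub; exact: smooth_near_dotr.
have s2 : smooth_near c2 x.
  by apply: smooth_near_mul; [exact: smooth_near_cst|exact: smooth_near_dotr].
have s12 : smooth_near (fun y => c1 y ^+ 2 + c2 y ^+ 2) x.
  by apply: smooth_near_add; exact: smooth_near_sqr.
have c12x : c1 x ^+ 2 + c2 x ^+ 2 = 0.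
  move: Z0; rewrite -(cvecK (Z x)) quadric_cvec => -[h1 h2].
  rewrite /c1 /c2 /X /Y !dotrE; set p := re_part _ in h1 h2 *.
  set q := im_part _ in h1 h2 *.
  have -> : dotr p p = dotr q q by lra.
  have -> : dotr p q = 0 by lra.
  by ring.
pose t y := Num.sqrt (1 - (c1 y ^+ 2 + c2 y ^+ 2) / 16).
have tx : 0 < 1 - (c1 x ^+ 2 + c2 x ^+ 2) / 16 by rewrite c12x mul0r subr0.
have st : smooth_near t x.
  apply: smooth_near_sqrt => //.
  apply: smooth_near_sub; first exact: smooth_near_cst.
  by apply: smooth_near_mul => //; exact: smooth_near_cst.
have t0 : 0 < t x by rewrite sqrtr_gt0.
pose S y := Num.sqrt (1 + t y).
have S0 : 0 < S x by rewrite sqrtr_gt0 addr_gt0.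
have sS : smooth_near S x.
  apply: smooth_near_sqrt; first by rewrite addr_gt0.
  by apply: smooth_near_add => //; exact: smooth_near_cst.
have sS4 : smooth_near (fun y => 4 * S y) x.
  by apply: smooth_near_mul => //; exact: smooth_near_cst.
pose a y := c1 y / (4 * S y); pose b y := c2 y / (4 * S y).
have S4 : 4 * S x != 0 by rewrite mulf_neq0// ?gt_eqF// ltr0n.
have sa : smooth_near a x by exact: smooth_near_div.
have sb : smooth_near b x by exact: smooth_near_div.
exists (fun y => cvec ((2 * t y)^-1 *: ((S y - a y) *: X y - b y *: Y y))
              (2^-1 *: ((S y + a y) *: Y y - b y *: X y))).
exists (fun y => a y +i* b y)%C; split=> //.
  apply: vsmooth_near_cvec; apply: rsmooth_near_scale.
  - apply: smooth_near_inv; first by rewrite mulf_neq0// gt_eqF// ltr0n.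
    by apply: smooth_near_mul => //; exact: smooth_near_cst.
  - apply: rsmooth_near_sub; apply: rsmooth_near_scale => //.
    exact: smooth_near_sub.
  - exact: smooth_near_cst.
  - apply: rsmooth_near_sub; apply: rsmooth_near_scale => //.
    exact: smooth_near_add.
near=> y.
have Ny : 0 < N y by near: y; exact: smooth_near_gt sN N0.
have Sy : 0 < Num.sqrt (N y) by rewrite sqrtr_gt0.
have ly : l y != 0 by rewrite mulf_neq0 ?invr_eq0 ?gt_eqF// ltr0n.
have XY4 : dotr (X y) (X y) + dotr (Y y) (Y y) = 4.
  rewrite /X /Y !dotrE; transitivity (l y ^+ 2 * N y); first by rewrite /N; ring.
  by rewrite /l expr_div_n sqr_sqrtr ?ltW// divfK ?gt_eqF//; ring.
have c16 : c1 y ^+ 2 + c2 y ^+ 2 < 16.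
  by near: y; apply: (smooth_near_lt s12); rewrite c12x.
have [TS nq sw red] := reduction_point_solve XY4 c16.
split=> //.
- rewrite nq sqrtr_gt0 subr_gt0 ltr_pdivrMr// mul1r; exact: c16.
- by rewrite nq; exact: sw.
- rewrite red hcoord_cvec_scale// cvecK//.
Unshelve. all: by end_near. Qed.

Definition CP_to_cut (b : set C3) : set C3 :=
  xget set0 [set c | cut c /\ cut_to_CP c = b].

Lemma cut_to_CPK c : cut c -> CP_to_cut (cut_to_CP c) = c.
Proof.
move=> cc; rewrite /CP_to_cut.
have [] : [set d | cut d /\ cut_to_CP d = cut_to_CP c]
    (xget set0 [set d | cut d /\ cut_to_CP d = cut_to_CP c]).
  by apply: xgetPex; exists c.
by move=> cd /cut_to_CP_inj; apply; exact: mem_set.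
Qed.

Lemma CP_to_cut_reduction_point z (w : R[i]) : TS2 z -> 0 < normq z ->
  normq z + (complex.Re w ^+ 2 + complex.Im w ^+ 2) = 1 ->
  cut_reduce z w (CP_to_cut (hcoord (reduction_point z w))) /\
  cut_to_CP (CP_to_cut (hcoord (reduction_point z w))) =
    hcoord (reduction_point z w).
Proof.
move=> TS t0 tw; have [c cr] := cut_reduce_exists w TS t0.
have [cc cE] := cut_reduce_to_CP TS t0 tw cr.
by rewrite -cE cut_to_CPK.
Qed.

(** Off the quadric a smooth lift to the open disc bundle exists; near the quadric,
    a smooth lift to the space of pairs [(z, w)] does. *)
Lemma CP_to_cut_smooth n (P : 'rV[R]_n -> set C3) (x : 'rV[R]_n) :
  CP_plots 2 n P x -> cut_plots (CP_to_cut \o P) x /\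
  \forall y \near x, cut_to_CP (CP_to_cut (P y)) = P y.
Proof.
move=> [Z [sZ ZP]]; have [Zx Px] := nbhs_singleton ZP.
have [Z0|ZN] := eqVneq (quadric (Z x)) 0.
  have [L [w [sL sw H]]] := lift_boundary sZ Zx Z0.
  have K y : (Z y != 0 /\ P y = hcoord (Z y)) ->
      [/\ TS2 (L y), 0 < normq (L y),
          normq (L y) + (complex.Re (w y) ^+ 2 + complex.Im (w y) ^+ 2) = 1
          & hcoord (reduction_point (L y) (w y)) = hcoord (Z y)] ->
      cut_reduce (L y) (w y) (CP_to_cut (P y)) /\
      cut_to_CP (CP_to_cut (P y)) = P y.
    by move=> [_ ->] [TS t0 tw <-]; exact: CP_to_cut_reduction_point.
  split; last by apply: filterS2 ZP H => y ZPy Hy; have [] := K y ZPy Hy.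
  right; exists L, w; split=> //; apply: filterS2 ZP H => y ZPy Hy.
  by have [cr _] := K y ZPy Hy; case: Hy.
have [L [sL H]] := lift_interior sZ ZN.
have K y : (Z y != 0 /\ P y = hcoord (Z y)) ->
    (U1S2 (L y) /\ hcoord (sphere_point (L y)) = hcoord (Z y)) ->
    CP_to_cut (P y) = cut_class (L y) /\ cut_to_CP (CP_to_cut (P y)) = P y.
  move=> [_ ->] [[TS t1] <-].
  have D : D1S2 (L y) by split=> //; exact: ltW.
  by rewrite -cut_to_CP_class// cut_to_CPK//; exists (L y).
split; last by apply: filterS2 ZP H => y ZPy Hy; have [] := K y ZPy Hy.
left; exists L; split=> //; apply: filterS2 ZP H => y ZPy Hy.
by have [cr _] := K y ZPy Hy; case: Hy.
Qed.

Lemma cut_to_CP_bij : set_bij cut (CP 2) (@cut_to_CP R).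
Proof.
split.
- move=> _ [z Dz <-]; rewrite cut_to_CP_class//.
  by exists (sphere_point z) => //; exact: sphere_point_neq0.
- exact: cut_to_CP_inj.
- move=> _ [z z0 <-].
  have P0 : CP_plots 2 0 (fun _ : 'rV[R]_0 => hcoord z) 0.
    exists (fun=> z); split; last by near=> y.
    by move=> j; split; exact: smooth_near_cst.
  have [/cut_plots_cut/nbhs_singleton /= H] := CP_to_cut_smooth P0.
  by move=> /nbhs_singleton /= e; exists (CP_to_cut (hcoord z)).
Unshelve. all: by end_near. Qed.

End SmoothMaps.

(** * The forms off the quadric *)

Section Forms.
Context {R : realType}.
Local Notation C3 := 'rV[R[i]]_3.
Implicit Types (z : C3) (c : set C3).

(** Compatibility with the identity of the source expresses both sides through the
    same velocities, whatever these are. *)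
Lemma two_form_local T (X : plots T) (a : two_form_data T) n
    (P Q : 'rV[R]_n -> T) (x u v : 'rV[R]_n) :
  two_form X a -> X n P x -> (\forall y \near x, Q y = P y) ->
  a n Q x u v = a n P x u v.
Proof.
move=> [_ _ fun_a] XP QP.
have sid : rsmooth_near id x by move=> j; exact: smooth_near_coord.
rewrite (fun_a _ _ P Q id x u v sid XP QP).
by rewrite [RHS](fun_a _ _ P P id x u v sid XP)//; near=> y.
Unshelve. all: by end_near. Qed.

(** The relations [a b = 1] and [<p, q> = 0] make the terms that involve the
    derivatives of the factors [a] and [b] cancel. *)
Lemma omega_std_sphere_point n (L : 'rV[R]_n -> C3) (x u v : 'rV[R]_n) :
  vsmooth_near L x -> (\forall y \near x, U1S2 (L y)) ->
  omega_std (velocity (fun y => sphere_point (L y)) x u)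
            (velocity (fun y => sphere_point (L y)) x v) =
  omega_std (velocity L x u) (velocity L x v).
Proof.
move=> sL UL; have sF := vsmooth_near_sphere_point sL (nbhs_singleton UL).
pose a y := stretch (im_part (L y)).
pose p y := re_part (L y); pose q y := im_part (L y).
have a1 y : a y != 0 by rewrite gt_eqF// stretch_gt0.
have sa : smooth_near a x := smooth_near_stretch sL (nbhs_singleton UL).
have dp w j : is_derive x w (fun y => p y 0 j) (re_part (velocity L x w) 0 j).
  by apply: is_derive_re; apply: smooth_near_derivable; exact: (sL j).1.
have dq w j : is_derive x w (fun y => q y 0 j) (im_part (velocity L x w) 0 j).
  by apply: is_derive_im; apply: smooth_near_derivable; exact: (sL j).2.
have da w : is_derive x w a ('D_w a x).
  by apply: derivableP; exact: smooth_near_derivable.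
pose b y := (a y)^-1.
have sb : smooth_near b x by exact: smooth_near_inv.
have db w : is_derive x w b ('D_w b x).
  by apply: derivableP; exact: smooth_near_derivable.
have ab w : a x * 'D_w b x + b x * 'D_w a x = 0.
  have [_ <-] := is_deriveM (da w) (db w).
  rewrite (_ : a * b = cst 1) ?derive_cst//.
  by apply: funext => y; exact: mulfV.
have pq w : dotr (p x) (im_part (velocity L x w)) + dotr (re_part (velocity L x w)) (q x) = 0.
  have [_ <-] := is_derive_dotr (dp w) (dq w).
  rewrite (@near_eq_derive _ _ _ _ (cst 0)) ?derive_cst//.
  by apply: filterS UL => y [[_ ?] _].
have reF w : re_part (velocity (fun y => sphere_point (L y)) x w) =
    'D_w a x *: p x + a x *: re_part (velocity L x w).
  apply/rowP => j.
  have [_ <-] : is_derive x w (fun y => re_part (sphere_point (L y)) 0 j)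
      (re_part (velocity (fun y => sphere_point (L y)) x w) 0 j).
    by apply: is_derive_re; apply: smooth_near_derivable; exact: (sF j).1.
  rewrite (_ : (fun y => _) = a * (fun y => p y 0 j)); last first.
    by apply: funext => y; rewrite re_cvec mxE.
  have [_ ->] := is_deriveM (da w) (dp w j).
  move: (re_part _) (p x) ('D_w a x) (a x) => p' px da' ax.
  by rewrite !mxE /GRing.scale /=; ring.
have imF w : im_part (velocity (fun y => sphere_point (L y)) x w) =
    'D_w b x *: q x + b x *: im_part (velocity L x w).
  apply/rowP => j.
  have [_ <-] : is_derive x w (fun y => im_part (sphere_point (L y)) 0 j)
      (im_part (velocity (fun y => sphere_point (L y)) x w) 0 j).
    by apply: is_derive_im; apply: smooth_near_derivable; exact: (sF j).2.
  rewrite (_ : (fun y => _) = b * (fun y => q y 0 j)); last first.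
    by apply: funext => y; rewrite im_cvec mxE.
  have [_ ->] := is_deriveM (db w) (dq w j).
  move: (im_part _) (q x) ('D_w b x) (b x) => q' qx db' bx.
  by rewrite !mxE /GRing.scale /=; ring.
have abx : a x * b x = 1 by exact: mulfV.
have pqx : dotr (p x) (q x) = 0 by have [[]] := nbhs_singleton UL.
rewrite /omega_std (reF u) (reF v) (imF u) (imF v); move: (ab u) (ab v) (pq u) (pq v) => abu abv pqu pqv.
move: abx pqx abu abv pqu pqv.
set pu := re_part _; set qu := im_part _; set pv := re_part _; set qv := im_part _.
move: (a x) (b x) (p x) (q x) pu qu pv qv ('D_u a x) ('D_u b x) ('D_v a x) ('D_v b x).
move=> c d p' q' {}pu {}qu {}pv {}qv cu du cv dv cd pq0 cdu cdv pqu pqv.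
rewrite !dotrE (dotrC q' p') (dotrC q' pv) (dotrC qu p') pq0.
have -> : dotr pu q' = - dotr p' qu by lra.
have -> : dotr pv q' = - dotr p' qv by lra.
transitivity ((c * du + d * cu) * dotr p' qv - (c * dv + d * cv) * dotr p' qu
  + c * d * (dotr pu qv - dotr qu pv)); first by ring.
by rewrite cdu cdv cd; ring.
Qed.

Lemma not_Q1 z : quadric z != 0 -> ~ Q1 (hcoord z).
Proof.
move=> z0 [z' [_ z'0] /hcoord_eq[a _ zE]].
by move/eqP: z0; apply; rewrite zE quadric_scale [quadric z']z'0 mulr0.
Qed.

Lemma Q1P z : z != 0 -> quadric z = 0 -> Q1 (hcoord z).
Proof. by move=> z0 zz; exists z. Qed.

Lemma quadric_sphere_point z : D1S2 z -> normq z < 1 -> quadric (sphere_point z) != 0.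
Proof.
have [p [q ->]] := cvecP z; rewrite D1S2_cvec normq_lt1 => -[pp pq q1] q1'.
have [e1 e2] := sphere_point_parts p q1.
rewrite sphere_point_cvec quadric_cvec !dotrE pp mulr1 -expr2 e1 mulrA -expr2 e2.
rewrite eq_complex /= negb_and (_ : 1 + _ - _ = 2 * Num.sqrt (1 - dotr q q)).
  by rewrite mulf_neq0 ?pnatr_eq0// gt_eqF// sqrtr_gt0 subr_gt0.
by ring.
Qed.

Lemma quadric_boundary z : TS2 z -> normq z = 1 -> quadric z = 0.
Proof.
have [p [q ->]] := cvecP z; rewrite TS2_cvec normq_eq1 => -[pp pq] qq.
by rewrite quadric_cvec pp pq qq subrr mulr0.
Qed.

(** The bilinear square of [sphere_point (p + i q)] is [2 sqrt (1 - |q|^2)], which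
    vanishes on the boundary only. *)
Lemma Q1_cut_to_CP c : cut c -> (Q1 (cut_to_CP c) <-> ~ U1RP2 c).
Proof.
move=> [z Dz <-]; split=> [Qz [z' Uz' zz']|NU].
  have [TSz' z'1] := Uz'.
  have Dz' : D1S2 z' by split=> //; exact: ltW.
  move: Qz; rewrite -zz' -cut_class_interior// cut_to_CP_class//.
  by apply: not_Q1; exact: quadric_sphere_point.
have [TSz] := Dz; rewrite le_eqVlt => /orP[/eqP z1|z1]; last first.
  by exfalso; apply: NU; exists z => //; rewrite cut_class_interior.
rewrite cut_to_CP_class//; apply: Q1P; first exact: sphere_point_neq0.
by rewrite sphere_point_boundary// quadric_boundary.
Qed.

(** A multiple of the point with bilinear square 1 has orthogonal real and imaginary
    parts, the real part being longer; it remains to make the latter a unit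
    vector.  Thus [iota'] maps onto the complement of the quadric. *)
Lemma U1S2_hcoord z : quadric z != 0 -> exists2 z', U1S2 z' & hcoord z' = hcoord z.
Proof.
move=> zz.
have [a [b [a0]]] := quadric_normalize zz.
rewrite -(hcoord_scale z a0).
have [p [q ->]] := cvecP ((a +i* b)%C *: z); rewrite quadric_cvec => -[pq1 pq].
have {}pq : dotr p q = 0 by lra.
have p0 : 0 < dotr p p by have := dotr_ge0 q; lra.
set N := Num.sqrt (dotr p p).
have N0 : N != 0 by rewrite gt_eqF// sqrtr_gt0.
have NN : N ^+ 2 = dotr p p by rewrite sqr_sqrtr// ltW.
exists (cvec (N^-1 *: p) (N^-1 *: q)); last by rewrite hcoord_cvec_scale// invr_eq0.
apply/U1S2_cvec; rewrite !dotrE pq -NN; split; [by field|by rewrite !mulr0|].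
rewrite mulrA -expr2 exprVn NN mulrC ltr_pdivrMr// mul1r; lra.
Qed.

Lemma quadric_reduction_point z (w : R[i]) : TS2 z -> 0 < normq z -> w != 0 ->
  quadric (reduction_point z w) != 0.
Proof.
have [p [q ->]] := cvecP z; case: w => a b.
rewrite TS2_cvec /reduction_point re_cvec im_cvec => -[pp pq] t0.
have qq := sqr_normq p q; set t := normq _ in t0 qq *.
have t1 : t != 0 by rewrite gt_eqF.
have S0 : Num.sqrt (1 + t) != 0 by rewrite gt_eqF// sqrtr_gt0 addr_gt0.
set S := Num.sqrt _ in S0 *.
rewrite quadric_cvec !dotrE (dotrC q p) pp pq -qq /= => w0.
rewrite (_ : (_ +i* _)%C = (4 * S +i* 0)%C * (a +i* b)%C).
  rewrite mulf_neq0// eq_complex /= eqxx andbT mulf_neq0// pnatr_eq0//.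
by apply/eqP; rewrite eq_complex /=; apply/andP; split; apply/eqP; field.
Qed.

Context (omega_FS omega_cut : @two_form_data R (set C3))
  (FS : fubini_study omega_FS) (cutF : cut_form omega_cut).

(** Such a plot lifts smoothly to the open disc bundle, where the form of the cut is
    [omega_std]; and [sphere_point], which preserves [omega_std], takes the lift to
    the sphere of square radius 2. *)
Lemma cut_form_off_Q1 n (P : 'rV[R]_n -> set C3) (x u v : 'rV[R]_n) :
  cut_plots P x -> ~ Q1 (cut_to_CP (P x)) ->
  2 * omega_FS (cut_to_CP \o P) x u v = omega_cut P x u v.
Proof.
move=> XP NQ.
have [Z [sZ ZP]] := cut_to_CP_smooth XP.
have [Zx /= Px] := nbhs_singleton ZP.
have [|L [sL H]] := lift_interior sZ (x := x).
  by apply/eqP => Z0; apply: NQ; rewrite Px; exact: Q1P.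
have UL : \forall y \near x, U1S2 (L y) by apply: filterS H => y [].
have PL : \forall y \near x, P y = cut_class (L y).
  apply: filterS3 ZP H (cut_plots_cut XP) => y [_ Py] [[TS L1] LZ] cP.
  have D : D1S2 (L y) by split=> //; exact: ltW.
  apply: cut_to_CP_inj; [exact: mem_set|by apply: mem_set; exists (L y)|].
  by rewrite cut_to_CP_class// LZ.
have XL : cut_plots (fun y => cut_class (L y)) x.
  by left; exists L; split=> //; apply: filterS UL.
have CL : CP_plots 2 n (fun y => hcoord (sphere_point (L y))) x.
  exists (fun y => sphere_point (L y)); split.
    exact: vsmooth_near_sphere_point (nbhs_singleton UL).
  apply: filterS UL => y [TS L1]; split=> //.
  by apply: sphere_point_neq0; split=> //; exact: ltW.
have [tFS FSE] := FS; have [tcut cutE] := cutF.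
rewrite (two_form_local u v tcut XL PL) cutE//.
rewrite (two_form_local u v tFS CL); last first.
  apply: filterS2 UL PL => y [TS L1] /= ->.
  by rewrite cut_to_CP_class//; split=> //; exact: ltW.
have s2 : Num.sqrt 2 ^+ 2 = 2 :> R by rewrite sqr_sqrtr.
rewrite -omega_std_sphere_point// -s2; apply: FSE.
- by rewrite sqrtr_gt0.
- exact: vsmooth_near_sphere_point (nbhs_singleton UL).
- apply: filterS UL => y [TS L1]; rewrite s2 sqnorm_sphere_point//.
  by split=> //; exact: ltW.
Qed.

End Forms.

(** * The forms on the whole cut *)

Section FormOnCut.
Context {R : realType}.
Local Notation C3 := 'rV[R[i]]_3.
Context (omega_FS omega_cut : @two_form_data R (set C3))
  (FS : fubini_study omega_FS) (cutF : cut_form omega_cut).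

(** A plot that meets the boundary may stay in it, so that density in the cut is of
    no direct use.  Where [w] vanishes at [x], adding a parameter [e] to the plot
    and replacing [w] by [w + e] gives a plot that restricts to the given one at
    [e = 0] and whose points over [x] are off the boundary for [e <> 0]; the two
    forms agree at these points, and hence at [e = 0] by continuity. *)
Lemma cut_formE n (P : 'rV[R]_n -> set C3) (x u v : 'rV[R]_n) :
  cut_plots P x -> 2 * omega_FS (cut_to_CP \o P) x u v = omega_cut P x u v.
Proof.
move=> XP; have [Qx|] := pselect (Q1 (cut_to_CP (P x))); last first.
  exact: cut_form_off_Q1.
case: (XP) => [[L [_ /nbhs_singleton[Ux Px]]]|[L [w [sL sw H]]]].
  exfalso; case: Ux => TSx x1; move: Qx; rewrite Px.
  have D : D1S2 (L x) by split=> //; exact: ltW.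
  by rewrite cut_to_CP_class//; apply: not_Q1; exact: quadric_sphere_point.
have [TSx tx twx crx] := nbhs_singleton H.
have wx : w x = 0.
  apply/eqP; apply: contrapT => /negP wx; move: Qx.
  have [_ ->] := cut_reduce_to_CP TSx tx twx crx.
  by apply: not_Q1; exact: quadric_reduction_point.
pose prj (y : 'rV[R]_(n + 1)) : 'rV[R]_n := lsubmx y.
pose e (y : 'rV[R]_(n + 1)) := y 0 (rshift n (0 : 'I_1)).
pose phi (y : 'rV[R]_n) : 'rV[R]_(n + 1) := row_mx y 0.
have prjphi y : prj (phi y) = y by exact: row_mxKl.
have ephi y : e (phi y) = 0 by rewrite /e /phi row_mxEr mxE.
have cprj : continuous prj by exact: continuous_lsubmx.
have sprj (g : 'rV[R]_n -> R) y : smooth_near g (prj y) -> smooth_near (g \o prj) y.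
  exact: (smooth_near_linear cprj).
pose a y := complex.Re (w (prj y)) + e y; pose b y := complex.Im (w (prj y)).
pose T y := 1 - (a y ^+ 2 + b y ^+ 2).
pose re y := re_part (L (prj y)); pose im y := im_part (L (prj y)).
pose t y := normq (L (prj y)).
pose L' y := cvec (re y) ((T y / t y) *: im y).
pose w' y := (a y +i* b y)%C.
pose x0 := phi x.
have Tx0 : T x0 = t x0.
  by rewrite /T /a /b /t ephi addr0 prjphi -[1]twx addrK.
have t0 : 0 < t x0 by rewrite /t prjphi.
have t1 : t x0 != 0 by rewrite gt_eqF.
have se : smooth_near e x0 by exact: smooth_near_coord.
have sa : smooth_near a x0.
  apply: smooth_near_add => //; apply: (sprj (fun y => complex.Re (w y))).
  by rewrite prjphi; case: sw.
have sb : smooth_near b x0.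
  by apply: (sprj (fun y => complex.Im (w y))); rewrite prjphi; case: sw.
have sT : smooth_near T x0.
  apply: smooth_near_sub; first exact: smooth_near_cst.
  by apply: smooth_near_add; exact: smooth_near_sqr.
have st : smooth_near t x0.
  by apply: (sprj (fun y => normq (L y))); rewrite prjphi; exact: smooth_near_normq.
have sre : rsmooth_near re x0.
  move=> j; apply: (sprj (fun y => re_part (L y) 0 j)).
  by rewrite prjphi; exact: vsmooth_near_re.
have sim : rsmooth_near im x0.
  move=> j; apply: (sprj (fun y => im_part (L y) 0 j)).
  by rewrite prjphi; exact: vsmooth_near_im.
have sL' : vsmooth_near L' x0.
  apply: vsmooth_near_cvec => //; apply: rsmooth_near_scale => //.
  exact: smooth_near_div.
pose good y := [/\ TS2 (L' y), 0 < normq (L' y) & normq (L' y) + (a y ^+ 2 + b y ^+ 2) = 1].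
have gd : \forall y \near x0, good y.
  have Hp : \forall y \near x0, TS2 (L (prj y)) /\ 0 < t y.
    have H' : \forall y \near prj x0, TS2 (L y) /\ 0 < normq (L y).
      by rewrite prjphi; apply: filterS H => y [].
    exact: (cprj x0 _ H').
  have T0 : 0 < T x0 by rewrite Tx0.
  apply: filterS2 Hp (smooth_near_gt sT T0) => y [TSy ty] Ty.
  have [pp pq] : dotr (re y) (re y) = 1 /\ dotr (re y) (im y) = 0 by [].
  have qq : dotr (im y) (im y) = t y ^+ 2 by rewrite -(sqr_normq (re y)) cvecK.
  have nT : normq (L' y) = T y.
    rewrite normq_cvec !dotrE qq -[RHS](ger0_norm (ltW Ty)) -sqrtr_sqr.
    by congr Num.sqrt; field; rewrite gt_eqF.
  split; [|by rewrite nT|by rewrite nT /T subrK].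
  by apply/TS2_cvec; rewrite dotrE pq mulr0.
pose P' y := CP_to_cut (hcoord (reduction_point (L' y) (w' y))).
have XP' : cut_plots P' x0.
  right; exists L', w'; split=> //; apply: filterS gd => y [TSy ty twy].
  split=> //.
  by have [] := CP_to_cut_reduction_point (w := w' y) TSy ty twy.
have PP' : \forall y \near x, P y = P' (phi y).
  apply: filterS2 H (cut_plots_cut XP) => y [TSy ty twy cry] cP.
  have [_ E] := cut_reduce_to_CP TSy ty twy cry.
  rewrite -[LHS](cut_to_CPK cP) E; congr (CP_to_cut (hcoord _)).
  have -> : w' (phi y) = w y.
    by rewrite /w' /a /b ephi addr0 prjphi; case: (w y).
  suff -> : L' (phi y) = L y by [].
  rewrite /L' /re /im.
  have -> : T (phi y) = t (phi y).
    by rewrite /T /a /b /t ephi addr0 prjphi -[1]twy addrK.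
  by rewrite /t prjphi divff ?gt_eqF// scale1r cvecK.
have sphi : rsmooth_near phi x.
  move=> j; rewrite (_ : (fun y => _) = (fun y : 'rV[R]_n =>
    match fintype.split j with inl k => y 0 k | inr _ => 0 end)).
    by case: fintype.split => k; [exact: smooth_near_coord|exact: smooth_near_cst].
  by apply: funext => y; rewrite mxE; case: fintype.split => // k; rewrite mxE.
have [tFS _] := FS; have [tcut _] := cutF.
have XC := cut_to_CP_smooth XP'.
have [_ smFS funFS] := tFS; have [_ smcut funcut] := tcut.
have PPC : \forall y \near x, (cut_to_CP \o P) y = (cut_to_CP \o P') (phi y).
  by apply: filterS PP' => y /= ->.
rewrite (funFS _ _ (cut_to_CP \o P') _ phi x u v sphi XC PPC).
rewrite (funcut _ _ P' _ phi x u v sphi XP' PP').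
move: (rvelocity phi x u) (rvelocity phi x v) => {}u {}v.
pose h y := 2 * omega_FS (cut_to_CP \o P') y u v - omega_cut P' y u v.
have sh : smooth_near h x0.
  apply: smooth_near_sub; last exact: smcut.
  by apply: smooth_near_mul; [exact: smooth_near_cst|exact: smFS].
apply/eqP; rewrite -subr_eq0 -/(h x0); apply: contrapT => /negP hx0.
have hN : \forall y \near x0, h y != 0.
  have ch := smooth_near_continuous sh.
  apply: (ch [set r : R | r != 0]).
  by apply: open_nbhs_nbhs; split; [exact: open_neq|].
pose d : 'rV[R]_(n + 1) := row_mx 0 (const_mx 1).
have path : (x0 + r *: d) @[r --> (0 : R)^'] --> x0.
  have : (x0 + r *: d) @[r --> (0 : R)^'] --> x0 + 0 *: d.
    apply: cvgD; first exact: cvg_cst.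
    by apply: cvgZr_tmp; exact: cvg_within.
  by rewrite scale0r addr0.
have [r [r0 [gr XPr hr]]] : exists r : R, r != 0 /\
    [/\ good (x0 + r *: d), cut_plots P' (x0 + r *: d) & h (x0 + r *: d) != 0].
  have F : \forall r \near (0 : R)^', [/\ good (x0 + r *: d),
      cut_plots P' (x0 + r *: d) & h (x0 + r *: d) != 0].
    apply: (path [set y | [/\ good y, cut_plots P' y & h y != 0]]).
    by apply: filterS3 gd (cut_plots_near XP') hN => y; split.
  have r0 : \forall r \near (0 : R)^', r != 0 by exact: nbhs_dnbhs_neq.
  have G : \forall r \near (0 : R)^', r != 0 /\ [/\ good (x0 + r *: d),
      cut_plots P' (x0 + r *: d) & h (x0 + r *: d) != 0].
    by apply: filterS2 r0 F => r; split.
  by have [r [? ?]] := filter_ex G; exists r.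
move/eqP: hr; apply; apply/eqP; rewrite subr_eq0; apply/eqP.
apply: cut_form_off_Q1 => //.
case: gr => TSr tr twr.
have [_ ->] := CP_to_cut_reduction_point (w := w' (x0 + r *: d)) TSr tr twr.
apply: not_Q1; apply: quadric_reduction_point => //.
rewrite /w' eq_complex negb_and /= /a (_ : prj _ = x); last first.
  by rewrite /prj linearD linearZ /= !row_mxKl scaler0 addr0.
rewrite wx add0r (_ : e _ = r) ?r0//.
by rewrite /e /x0 /phi mxE row_mxEr [X in _ + X]mxE row_mxEr !mxE add0r mulr1.
Unshelve. all: by end_near. Qed.

End FormOnCut.

(** * The identification of the cut with the projective plane *)

Section Identification.
Context {R : realType}.
Local Notation C3 := 'rV[R[i]]_3.

Lemma quadric_U1S2 (z : C3) : U1S2 z -> quadric z != 0.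
Proof.
have [p [q ->]] := cvecP z; rewrite U1S2_cvec quadric_cvec => -[-> _ qq].
by rewrite eq_complex negb_and /= subr_eq0 gt_eqF.
Qed.

Context (A : @plots R (set C3)) (Phi : set C3 -> set C3)
  (PhiP : cut_identification A Phi).

Lemma Phi_antip z : U1S2 z -> Phi (antip z) = hcoord z.
Proof.
by have [_ _ PhiE] := PhiP => Uz; rewrite PhiE ?iota'E//; exists z.
Qed.

(** The identification extends [iota'], which maps the disc bundle onto the
    complement of the quadric; being bijective, it maps the rest of the cut onto the
    quadric, as [cut_to_CP] does by [Q1_cut_to_CP]. *)
Lemma Q1_identification c : cut c -> (Q1 (Phi c) <-> ~ U1RP2 c).
Proof.
have [_ [[cutCP inj _] _ _] _] := PhiP => cc.
split=> [Qc [z Uz zc]|NU].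
  by move: Qc; rewrite -zc Phi_antip//; apply: not_Q1; exact: quadric_U1S2.
apply: contrapT => NQ; apply: NU.
have [Z Z0 ZE] := cutCP _ cc; rewrite -ZE in NQ.
have [|z Uz zZ] := @U1S2_hcoord R Z.
  by apply/eqP => ZZ; apply: NQ; exact: Q1P.
have U : U1RP2 (antip z) by exists z.
suff -> : c = antip z by [].
apply: inj; rewrite ?inE//; first exact: U1RP2_sub_cut.
by rewrite Phi_antip// zZ.
Qed.

End Identification.

Theorem proposition2p6 (R : realType)
  (A : @plots R (set 'rV[R[i]]_3))
  (Phi : set 'rV[R[i]]_3 -> set 'rV[R[i]]_3)
  (omega_FS omega_cut omega_bar : @two_form_data R (set 'rV[R[i]]_3)) :
  fubini_study omega_FS ->
  cut_form omega_cut ->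
  cut_identification A Phi ->
  two_form A omega_bar ->
  eq_form cut_plots (pullback Phi omega_bar) omega_cut ->
  exists f : set 'rV[R[i]]_3 -> set 'rV[R[i]]_3,
    [/\ diffeomorphism (CP 2) A (CP 2) (CP_plots 2) f,
        eq_form A (pullback f (scale_form 2 omega_FS)) omega_bar,
        f @` RP2 = RP2
      & f @` Q1 = Q1].
Proof.
move=> FS cutF PhiP tbar eqbar.
have [[inA _ _ _ _] [[PhiCP Phiinj Phisurj] sPhi [g [sg gK gcut]]] _] := PhiP.
have Kg b : CP 2 b -> Phi (g b) = b by move=> /Phisurj[c cc <-]; rewrite gK.
have [psiCP psiinj psisurj] := @cut_to_CP_bij R.
exists (cut_to_CP \o g); split.
- split.
  + split=> [b /gcut/psiCP //|b b' /set_mem Cb /set_mem Cb' /= e|b].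
      have {}e : g b = g b'.
        by apply: psiinj e; apply: mem_set; exact: gcut.
      by rewrite -(Kg b)// e Kg.
    by move=> /psisurj[c cc <-]; exists (Phi c); [exact: PhiCP|rewrite /= gK].
  + by move=> n P x AP; exact: cut_to_CP_smooth (sg _ _ _ AP).
  + exists (Phi \o CP_to_cut); split.
    * move=> n P x XP; have [cP _] := CP_to_cut_smooth XP; exact: sPhi cP.
    * by move=> b Cb /=; rewrite cut_to_CPK ?Kg//; exact: gcut.
    * by move=> b /psisurj[c cc <-] /=; rewrite cut_to_CPK//; exact: PhiCP.
- move=> n P x u v AP.
  rewrite /pullback /scale_form (cut_formE FS cutF u v (sg _ _ _ AP)).
  rewrite -(eqbar _ _ _ _ _ (sg _ _ _ AP)).
  apply: (two_form_local u v tbar AP).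
  by apply: filterS (inA _ _ _ AP) => y Py /=; rewrite Kg.
(* On the zero section, [sphere_point] is a multiplication by a positive factor. *)
- have fix_RP2 b : RP2 b -> (cut_to_CP \o g) b = b.
    move=> [z [z0 z1] <-].
    have zE : z = cvec (re_part z) 0 by rewrite -{1}(cvecK z) z1.
    rewrite {}zE in z0 *; move: (re_part z) z0 => p.
    rewrite cvec_eq0 eqxx andbT -dotr_gt0 => p0.
    have N0 : (Num.sqrt (dotr p p))^-1 != 0 by rewrite invr_eq0 gt_eqF// sqrtr_gt0.
    rewrite -(hcoord_cvec_scale _ _ N0) scaler0.
    set p1 := _ *: p.
    have p11 : dotr p1 p1 = 1.
      rewrite /p1 !dotrE mulrA -expr2 exprVn sqr_sqrtr ?ltW// mulVf// gt_eqF//.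
    have U : U1S2 (cvec p1 0) by apply/U1S2_cvec; rewrite p11 !dotr0r.
    rewrite /= -(Phi_antip PhiP U) gK; last by apply: U1RP2_sub_cut; exists (cvec p1 0).
    rewrite (Phi_antip PhiP U) -cut_class_interior// cut_to_CP_class; last first.
      by case: U => ? /ltW.
    have A0 : stretch (0 : 'rV[R]_3) != 0 by rewrite gt_eqF// stretch_gt0.
    by rewrite sphere_point_cvec -[RHS](hcoord_cvec_scale _ _ A0) !scaler0.
  apply/seteqP; split=> [_ [b Rb <-]|b Rb]; first by rewrite fix_RP2.
  by exists b; rewrite ?fix_RP2.
- have Q1CP (b : set 'rV[R[i]]_3) : Q1 b -> CP 2 b by move=> [z [z0 _] <-]; exists z.
  have fQ c : cut c -> (cut_to_CP \o g) (Phi c) = cut_to_CP c.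
    by move=> cc; rewrite /= gK.
  have Q1E c : cut c -> (Q1 (Phi c) <-> Q1 (cut_to_CP c)).
    by move=> cc; rewrite (Q1_identification PhiP cc) Q1_cut_to_CP.
  apply/seteqP; split=> [_ [b Qb <-]|b Qb].
    have [c cc cE] := Phisurj _ (Q1CP _ Qb).
    by rewrite -cE fQ// -Q1E// cE.
  have [c cc cE] := psisurj _ (Q1CP _ Qb).
  by exists (Phi c); [apply/(Q1E _ cc); rewrite cE|rewrite fQ].
Qed.
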